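(* (Balanced Lasota–Yorke Inequality.) Let $X$ and $T$ satisfy the assumptions $(\mathcal{M})$ listed in the context. Suppose further that $$\sup_{n\in N}\left\{\frac{\operatorname{Var}_{I_n^o}(g)}{\lambda(I_n)}\right\}<\infty\quad\text{and}\quad\sum_{(z,s)\in H}g(z^s)<\infty.$$ Then for any $f\in BV(X,\lambda)$ and any finite collection of closed intervals $\mathcal{J}=\{J_m\}_{m=1}^M$ with disjoint non-empty interiors such that $\bigcup_{m=1}^MJ_m$ contains $H$ (each $(z,s)\in H$ satisfies $(z,s)\in J_m$ for some $m$), we have $$\operatorname{Var}(L(f))\le\left(\sup_n\left\{\left\|g|_{I_n^o}\right\|_\infty+\operatorname{Var}_{I_n^o}(g)\right\}+\max_m\{h_{\mathcal{J}}(m)\}\right)\operatorname{Var}(f)+\left(\sup_n\left\{\frac{\operatorname{Var}_{I_n^o}(g)}{\lambda(I_n)}\right\}+\max_m\left\{\frac{h_{\mathcal{J}}(m)}{\lambda(J_m)}\right\}\right)\|f\|_1,$$ where $h_{\mathcal{J}}(m):=\sum_{(z,s)\in H\cap J_m}g(z^s)$.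
   Context: Assumptions $(\mathcal{M})$: $X=[a_X,b_X]$ is a totally ordered, order-complete set with its order topology, without isolated points, equipped with a complete regular Borel probability measure $\lambda$. $\{I_n\}_{n\in N}$ is a countable (finite or infinite) cover of $X$ by closed intervals $I_n=[a_n,b_n]$ with $a_n<b_n$; $I_n^o$ denotes $(a_n,b_n)$. One has $I_n^o\cap I_m^o=\emptyset$ for $n\ne m$, and $\bigcup_nI_n^o$ is dense and has measure $1$. $T:X\to X$ is a map such that: - $T|_{I_n^o}$ is continuous and extends to a homeomorphism $T_n:I_n\to T_n(I_n)\subset X$ for each $n$; - there is a bounded measurable function $g:X\to[0,\infty)$ such that $L(f)(x):=\sum_{y\in T^{-1}(x)}g(y)f(y)$ defines an operator that preserves $\lambda$ (i.e. $\int L(f)\,d\lambda=\int f\,d\lambda$ for all $f\in L^1(X,\lambda)$), $g$ has one-sided limits at the endpoints of each $I_n$, and $g$ equals $0$ at the endpoints of each $I_n$; - the intervals $I_n$ are as large as possible (the endpoints are places where $T$ is not continuous or not monotone). One-tailed points: for $x\in X$, $s\in\{+,-\}$ and a closed interval $I\subset X$, write $(x,+)\in I$ if $x\in I$ and $x$ is in the closure of $I\cap\{y:y>x\}$; write $(x,-)\in I$ if $x\in I$ and $x$ is in the closure of $I\cap\{y:y<x\}$. For a function $f$, $f(x^s)=\lim_{y\to x^s}f(y)$ is the one-sided limit from the $s$ side, when it exists. Hanging points: let $E=\{(x,s)\in X:x\in\{a_n,b_n\}_n,\ s\in\{+,-\}\}$. A point $(x,s)\in E$ is a hanging point for $T$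 if $T(x^s)\notin\{a_X,b_X\}$. $H$ denotes the set of all hanging points, and $H\cap J_m$ is the set of $(z,s)\in H$ with $(z,s)\in J_m$, meaning that $z\in J_m$ and $z$ is in the closure of $J_m\cap\{y:y>z\}$ if $s=+$, respectively in the closure of $J_m\cap\{y:y<z\}$ if $s=-$. Variation: for $f:X\to\mathbb{R}$ and nonempty $C\subset X$, the pointwise variation is the supremum of $\sum_{i=1}^m|f(x_i)-f(x_{i-1})|$ over finite sequences $x_0<\cdots<x_m$ in $C$. For a $\lambda$-equivalence class, $\operatorname{Var}_C(f)$ denotes the infimum of the pointwise variations on $C$ over all functions $\lambda$-a.e. equal to $f$, and $\operatorname{Var}=\operatorname{Var}_X$. $BV(X,\lambda)$ is the set of classes $f\in L^\infty(X,\lambda)$ with $\operatorname{Var}(f)<\infty$. $\|\cdot\|_1$ is the $L^1(\lambda)$ norm.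
   Formalization: The variation of g on I_n^o is pointwise; each T_n is monotone onto an interval, and a_n, b_n are limits of points inside I_n (automatic if X is connected); overlaps of distinct J_m are λ-null (automatic without atoms). The claim fails otherwise. *)

(* Defs.v *)
From HB Require Import structures.
From mathcomp Require Import all_boot all_order all_algebra.
From mathcomp Require Import all_classical all_reals all_analysis.

Set Implicit Arguments.
Unset Strict Implicit.
Unset Printing Implicit Defensive.

Import Order.TTheory GRing.Theory Num.Theory.
Import numFieldTopology.Exports numFieldNormedType.Exports.

Local Open Scope classical_set_scope.
Local Open Scope ring_scope.

(* An ordered topological space together with a sigma-algebra. The library has
   no join of orderTopologicalType and measurableType, and its hierarchy does
   not admit one after the fact, so the two are packed by hand. The point only
   serves to make the type pointed, as measurableType requires. *)
Record measurableOrderTopologicalType (d : Order.disp_t) := {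
  mot_carrier : orderTopologicalType d;
  mot_point : mot_carrier;
  mot_sets : set (set mot_carrier);
  mot_sigma_algebra : sigma_algebra [set: mot_carrier] mot_sets }.

Definition mot_sort (d : Order.disp_t) (X : measurableOrderTopologicalType d)
  : Type := mot_carrier X.
Coercion mot_sort : measurableOrderTopologicalType >-> Sortclass.

Section MotInstances.
Context (d : Order.disp_t) (X : measurableOrderTopologicalType d).

Lemma mot_measurable0 : mot_sets (m := X) set0.
Proof. by have [] := mot_sigma_algebra X. Qed.

Lemma mot_measurableC (A : set (mot_sort X)) :
  mot_sets (m := X) A -> mot_sets (m := X) (~` A).
Proof.
move=> mA; have [_ h _] := mot_sigma_algebra X.
by rewrite -setTD; exact: h.
Qed.

Lemma mot_measurable_bigcup (F : (set (mot_sort X))^nat) :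
  (forall i, mot_sets (m := X) (F i)) -> mot_sets (m := X) (\bigcup_i F i).
Proof. by move=> mF; have [_ _ h] := mot_sigma_algebra X; exact: h. Qed.

HB.instance Definition _ := OrderTopological.on (mot_sort X).
HB.instance Definition _ := isPointed.Build (mot_sort X) (mot_point X).
HB.instance Definition _ := @isMeasurable.Build default_measure_display
  (mot_sort X) (mot_sets (m := X))
  mot_measurable0 mot_measurableC mot_measurable_bigcup.

End MotInstances.

(* One-tailed points: (x, true) stands for (x, +), (x, false) for (x, -). *)
Section OneTailed.
Context {d : Order.disp_t} {X : orderTopologicalType d}.

Definition side (p : X * bool) : set X :=
  [set y | if p.2 then (p.1 < y)%O else (y < p.1)%O].

Definition tail_mem (I : set X) (p : X * bool) : Prop :=
  I p.1 /\ closure (I `&` side p) p.1.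

Definition one_sided (p : X * bool) : set_system X :=
  within (side p) (nbhs p.1).

Definition ccI (u v : X) : set X := [set` `[u, v]].
Definition ooI (u v : X) : set X := [set` `]u, v[].

End OneTailed.

Section Variation.
Context {d : Order.disp_t} {R : realType}.
Context {X : measurableOrderTopologicalType d}.
Implicit Types (C : set X) (f : X -> R).

Definition pointwise_variation C f : \bar R :=
  ereal_sup [set r | exists (m : nat) (x : nat -> X),
    [/\ forall i, (i <= m)%N -> C (x i),
        forall i, (i < m)%N -> (x i < x i.+1)%O
      & r = (\sum_(i < m) `|f (x i.+1) - f (x i)|)%:E]].

(* Variation of the class of f modulo equality almost everywhere. The weight g
   below is a function rather than a class (null sets on which g vanishes may
   have images of positive measure, and transfer T g sees them), so its
   variation is the pointwise one. *)
Definition class_variation (mu : set X -> \bar R) C f : \bar R :=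
  ereal_inf [set pointwise_variation C f' |
    f' in [set f' : X -> R | {ae mu, forall x, f' x = f x}]].

Definition bounded_var (mu : {measure set X -> \bar R}) f : Prop :=
  f \in Lfun mu +oo%E /\ (class_variation mu [set: X] f < +oo)%E.

Definition complete_regular_borel (mu : set X -> \bar R) : Prop :=
  [/\ forall U : set X, open U -> measurable U,
      measure_is_complete mu,
      forall A : set X, measurable A ->
        mu A = ereal_inf [set mu U | U in [set U : set X | open U /\ A `<=` U]]
    & forall A : set X, measurable A ->
        mu A = ereal_sup [set mu K | K in [set K : set X | [/\ compact K,
          measurable K & K `<=` A]]]].

End Variation.

Section TransferOperator.
Context {d : Order.disp_t} {R : realType}.
Context {X : measurableOrderTopologicalType d}.
Implicit Types (T : X -> X) (g f : X -> R).

(* The sum over the fibre; meaningful where it converges absolutely. *)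
Definition transfer T g f (x : X) : R :=
  let u := EFin \o (fun y => g y * f y) in
  fine (\esum_(y in T @^-1` [set x]) u^\+ y
        - \esum_(y in T @^-1` [set x]) u^\- y).

Definition transfer_preserves (mu : {measure set X -> \bar R}) T g : Prop :=
  forall f : X -> R, mu.-integrable [set: X] (EFin \o f) ->
    [/\ {ae mu, forall x,
          summable (T @^-1` [set x]) (fun y => (g y * f y)%:E)},
        mu.-integrable [set: X] (EFin \o transfer T g f)
      & (\int[mu]_x (transfer T g f x)%:E = \int[mu]_x (f x)%:E)%E].

End TransferOperator.

Section Branches.
Context {d : Order.disp_t} {X : orderTopologicalType d}.
Implicit Types (T : X -> X) (u v : X).

(* [u, v] is an interval on whose interior T is continuous and extends to a
   monotone homeomorphism from [u, v] onto an interval. If X is connected, then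
   the two conditions tail_mem, the monotonicity and the shape of the image
   follow from the other conditions; they matter when X has jumps, as a Cantor
   set does. *)
Definition branch T u v : Prop :=
  [/\ (u < v)%O,
      tail_mem (ccI u v) (u, true),
      tail_mem (ccI u v) (v, false),
      {within ooI u v, continuous T}
    & exists Tn Sn : X -> X,
      [/\ forall x, ooI u v x -> Tn x = T x,
          {within ccI u v, continuous Tn}
            /\ {within Tn @` ccI u v, continuous Sn},
          forall x, ccI u v x -> Sn (Tn x) = x,
          (forall x y, ccI u v x -> ccI u v y -> (x < y)%O -> (Tn x < Tn y)%O)
          \/ (forall x y, ccI u v x -> ccI u v y -> (x < y)%O -> (Tn y < Tn x)%O)
        & exists u' v' : X, Tn @` ccI u v = ccI u' v']].

Context {N : Type} (a b : N -> X).

Definition endpoint_tail (p : X * bool) : Prop :=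
  tail_mem [set: X] p /\ exists n, p.1 = a n \/ p.1 = b n.

(* A tail where T has no limit is not hanging. *)
Definition hanging (aX bX : X) T : set (X * bool) :=
  [set p | endpoint_tail p /\
    exists l : X, [/\ T @ one_sided p --> l, l <> aX & l <> bX]].

End Branches.

Section StandingAssumptions.
Context {d : Order.disp_t} {R : realType}.
Context {X : measurableOrderTopologicalType d}.

Record standing_assumptions (aX bX : X) (mu : probability X R)
    (N : countType) (a b : N -> X) (T : X -> X) (g : X -> R) : Prop := {
  sa_bounds : forall x : X, (aX <= x <= bX)%O;
  sa_complete : forall A : set X, A !=set0 -> supremums A !=set0;
  sa_no_isolated : isolated [set: X] = set0;
  sa_measure : complete_regular_borel mu;
  sa_cover : \bigcup_n ccI (a n) (b n) = [set: X];
  sa_disjoint : forall n m, n <> m ->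
    ooI (a n) (b n) `&` ooI (a m) (b m) = set0;
  sa_dense : dense (\bigcup_n ooI (a n) (b n));
  sa_full : mu (\bigcup_n ooI (a n) (b n)) = 1%E;
  sa_branch : forall n, branch T (a n) (b n);
  (* The intervals are as large as possible. This follows if every endpoint
     other than aX and bX has no neighbourhood on which T is monotone, or is a
     point of discontinuity of T. *)
  sa_maximal : forall n u v, branch T u v ->
    ccI (a n) (b n) `<=` ccI u v -> u = a n /\ v = b n;
  sa_g_ge0 : forall x, 0 <= g x;
  sa_g_bounded : exists B : R, forall x, g x <= B;
  sa_g_measurable : measurable_fun [set: X] g;
  sa_preserves : transfer_preserves mu T g;
  sa_g_limits : forall p, endpoint_tail a b p -> cvg (g @ one_sided p);
  sa_g_endpoints : forall n, g (a n) = 0 /\ g (b n) = 0 }.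

(* g (z^s) summed over the hanging points (z, s) in J. *)
Definition hanging_weight (aX bX : X) (N : countType) (a b : N -> X)
    (T : X -> X) (g : X -> R) (J : set X) : \bar R :=
  (\esum_(p in hanging a b aX bX T `&` tail_mem J)
     (lim (g @ one_sided p))%:E)%E.

End StandingAssumptions.

(* Main.v *)
Require Import Defs.
From HB Require Import structures.
From mathcomp Require Import all_boot all_order all_algebra.
From mathcomp Require Import all_classical all_reals all_analysis.
From mathcomp Require Import measurable_realfun ess_sup_inf ring lra.

Set Implicit Arguments.
Unset Strict Implicit.
Unset Printing Implicit Defensive.

Import Order.TTheory GRing.Theory Num.Theory.
Import numFieldTopology.Exports numFieldNormedType.Exports.

Local Open Scope classical_set_scope.
Local Open Scope ring_scope.

(** Replace [f] by a representative [f'] of variation at most [V] and let [y_n] be the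
    inverse of the n-th branch, extended by the endpoints of [I_n], where [g] vanishes.
    Almost everywhere [L f = sum_n phi_n] with [phi_n x = (g f') (y_n x)], because [g]
    vanishes at the preimages of almost every point that lie in a given null set. For the
    same reason [g] may be bounded by its essential supremum on [I_n]. The variation of [phi_n] is
    bounded by that of [g f'] on [I_n], estimated with the product rule and
    [|f'| <= mean of |f| + oscillation] on [I_n], plus the jumps of [phi_n] at the two
    extremities of the range of the branch. There is no jump at [aX] or [bX], which have
    measure zero; any other jump comes from a hanging point [p] in some [J_m] and is
    at most [g(p)] times the sum of the mean of [|f|] on [J_m] and the oscillation of
    [f'] there.
    Summing over [n] and [m] is possible since the oscillations over pairwise separated
    sets add up to at most [V]. *)

(** * Variation and oscillation *)

Section VariationFunctions.
Context {d : Order.disp_t} {R : realType}.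
Context {X : measurableOrderTopologicalType d}.
Implicit Types (C : set X) (f W : X -> R) (V : R).

(** A variation bound in the form of a control function. It restricts to subsets and survives
    composition with monotone maps, up to a sign. It can also be localised, since the increments of
    a nondecreasing [W] over separated sets add up to at most its total increase. *)
Definition dominates C W f :=
  forall x y, C x -> C y -> (x <= y)%O -> `|f y - f x| <= W y - W x.

Lemma pointwise_variation_le C f V :
  (forall m (x : nat -> X), (forall i, (i <= m)%N -> C (x i)) ->
    (forall i, (i < m)%N -> (x i < x i.+1)%O) ->
    \sum_(i < m) `|f (x i.+1) - f (x i)| <= V) ->
  (pointwise_variation C f <= V%:E)%E.
Proof.
move=> h; apply: ge_ereal_sup => _ [m [x [Cx xlt ->]]].
by rewrite lee_fin; exact: h.
Qed.

Lemma chain_dominated C W f m (x : nat -> X) : dominates C W f ->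
  (forall i, (i <= m)%N -> C (x i)) ->
  (forall i, (i < m)%N -> (x i < x i.+1)%O) ->
  \sum_(i < m) `|f (x i.+1) - f (x i)| <= W (x m) - W (x 0).
Proof.
move=> dW; elim: m => [|m ih] Cx xlt; first by rewrite big_ord0 subrr.
rewrite big_ord_recr/= -[leRHS](subrKA (W (x m))) addrC.
apply: lerD; first by apply: dW; [exact: Cx|exact: Cx|exact/ltW/xlt].
by apply: ih => i im; [apply: Cx; exact: leqW|apply: xlt; exact: leqW].
Qed.

Lemma dominated_variation C W f V : dominates C W f ->
  (forall x, 0 <= W x <= V) -> (pointwise_variation C f <= V%:E)%E.
Proof.
move=> dW W0; apply: pointwise_variation_le => m x Cx xlt.
rewrite (le_trans (chain_dominated dW Cx xlt))//.
by have := W0 (x m); have := W0 (x 0); lra.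
Qed.

(** The witness is Jordan's variation function, the supremum of the sums over chains in [C] that end
    at or below [x]. Prolonging such a chain through [x] to [y] gives domination. *)
Lemma variation_function C f V : 0 <= V ->
  (pointwise_variation C f <= V%:E)%E ->
  exists W, [/\ forall x, 0 <= W x <= V, {homo W : x y / (x <= y)%O}
    & dominates C W f].
Proof.
move=> V0 hV.
pose ch (x : X) := [set s : R | exists m z, [/\ forall i, (i <= m)%N -> C (z i),
  forall i, (i < m)%N -> (z i < z i.+1)%O, (z m <= x)%O &
  s = \sum_(i < m) `|f (z i.+1) - f (z i)|]].
(* [0] is added because no point of [C] need lie at or below [x]. *)
pose S x := [set 0] `|` ch x.
have SV x s : S x s -> s <= V.
  move=> [->//|[m [z [Cz zlt zx ->]]]].
  rewrite -lee_fin (le_trans _ hV)//; apply: ereal_sup_ubound.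
  by exists m, z; split.
have hS x : has_sup (S x).
  by split; [exists 0; left|exists V => s; exact: SV].
have S_le x s : S x s -> s <= sup (S x) by move=> Ss; apply: sup_upper_bound.
exists (fun x => sup (S x)); split.
- move=> x; rewrite S_le/=; last by left.
  by apply: ge_sup; [exists 0; left|exact: SV].
- move=> x y xy; apply: ge_sup; first by exists 0; left.
  move=> s Ss; apply: S_le; case: Ss => [|[m [z [Cz zlt zx ->]]]]; first by left.
  by right; exists m, z; split => //; exact: le_trans xy.
move=> x y Cx Cy; rewrite le_eqVlt => /predU1P[->|xy]; first by rewrite !subrr normr0.
rewrite lerBrDr -lerBrDl; apply: ge_sup; first by exists 0; left.
have app m (z : nat -> X) w : (forall i, (i <= m)%N -> C (z i)) ->
    (forall i, (i < m)%N -> (z i < z i.+1)%O) -> C w -> (z m < w)%O ->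
    ch w (\sum_(i < m) `|f (z i.+1) - f (z i)| + `|f w - f (z m)|).
  move=> Cz zlt Cw zw; exists m.+1, (fun i => if (i <= m)%N then z i else w).
  split.
  - by move=> i _; case: leqP => // im; exact: Cz.
  - move=> i; rewrite ltnS => im; rewrite im.
    by case: leqP => [mi|im']; [have -> : i = m by apply/eqP; rewrite eqn_leq im|exact: zlt].
  - by rewrite ltnn.
  rewrite big_ord_recr/= leqnn ltnn; congr (_ + _).
  by apply: eq_bigr => i _; rewrite (ltnW (ltn_ord i)) ltn_ord.
move=> s [->|[m [z [Cz zlt zx ->]]]]; rewrite lerBrDl.
  rewrite addr0; apply: S_le; right.
  by have := app 0 (fun=> x) y; rewrite big_ord0 add0r; apply.
rewrite addrC.
move: zx; rewrite le_eqVlt => /predU1P[zx|zx].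
  by apply: S_le; right; rewrite -zx; apply: app => //; rewrite zx.
(* The chain stops short of [x]; the increment up to [x] is nonnegative, so it may be inserted
   before the step to [y]. *)
apply: (@le_trans _ _ (\sum_(i < m) `|f (z i.+1) - f (z i)| + `|f x - f (z m)| + `|f y - f x|)).
  by rewrite lerD2r lerDl.
apply: S_le; right.
pose z' i := if (i <= m)%N then z i else x.
have := app m.+1 z' y; rewrite big_ord_recr/= /z' leqnn ltnn.
under eq_bigr => i _ do rewrite (ltnW (ltn_ord i)) ltn_ord.
apply => //.
  by move=> i _; case: leqP => // im; exact: Cz.
move=> i; rewrite ltnS => im; rewrite im.
by case: leqP => [mi|im']; [have -> : i = m by apply/eqP; rewrite eqn_leq im|exact: zlt].
Qed.

(* The infimal convolution is McShane's Lipschitz extension, for the pseudometric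
   [|W x - W y|], of the restriction of [F] to [D]. *)
Lemma dominated_extension D W F : D !=set0 -> {homo W : x y / (x <= y)%O} ->
  dominates D W F -> exists G : X -> R, {in D, G =1 F} /\ dominates setT W G.
Proof.
move=> [x0 Dx0] Wm dW.
have FW x y : D x -> D y -> F x <= F y + `|W x - W y|.
  move=> Dx Dy; have [xy|/ltW xy] := leP x y.
    have := dW _ _ Dx Dy xy; rewrite ler_norml distrC.
    rewrite (ger0_norm (x := W y - W x)) ?subr_ge0 ?Wm//; lra.
  have := dW _ _ Dy Dx xy; rewrite ler_norml.
  rewrite (ger0_norm (x := W x - W y)) ?subr_ge0 ?Wm//; lra.
pose S x := [set F y + `|W x - W y| | y in D].
have S0 x : S x !=set0 by exists (F x0 + `|W x - W x0|); exists x0.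
have hS x : has_inf (S x).
  split => //; exists (F x0 - `|W x - W x0|) => _ [y Dy <-].
  have := FW _ _ Dx0 Dy; have := ler_distD (W x) (W x0) (W y).
  rewrite (distrC (W x0) (W x)); lra.
have GS x y : D y -> inf (S x) <= F y + `|W x - W y|.
  by move=> Dy; apply: ge_inf; [case: (hS x)|exists y].
have GL x y : inf (S x) <= inf (S y) + `|W x - W y|.
  rewrite -lerBlDr; apply: lb_le_inf => // _ [z Dz <-].
  have := GS x z Dz; have := ler_distD (W y) (W x) (W z); lra.
exists (fun x => inf (S x)); split.
  move=> x; rewrite inE => Dx; apply/eqP; rewrite eq_le; apply/andP; split.
    by have := GS x x Dx; rewrite subrr normr0 addr0.
  by apply: lb_le_inf => // _ [y Dy <-]; exact: FW.
move=> x y _ _ xy; rewrite ler_norml.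
have := GL x y; have := GL y x; rewrite (distrC (W x)).
rewrite (ger0_norm (x := W y - W x)) ?subr_ge0 ?Wm//; lra.
Qed.

(** The variation function of [F] on [D] still dominates an extension of [F|D] to the whole space,
    and this extension is a representative of the class of [f]. It therefore suffices to estimate
    chains of good points. *)
Lemma class_variation_conull (mu : {measure set X -> \bar R}) D F f V : D !=set0 ->
  mu.-negligible (~` D) -> (forall x, D x -> F x = f x) ->
  (pointwise_variation D F <= V%:E)%E -> (class_variation mu setT f <= V%:E)%E.
Proof.
move=> D0 nD Ff vV.
have V0 : 0 <= V.
  have [x Dx] := D0; rewrite -lee_fin (le_trans _ vV)//; apply: ereal_sup_ubound.
  by exists 0, (fun=> x); split => //; rewrite big_ord0.
have [W [WV Wm dW]] := variation_function V0 vV.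
have [G [GF dG]] := dominated_extension D0 Wm dW.
apply: le_trans (dominated_variation dG WV).
apply: ereal_inf_lbound; exists G => //=.
apply: negligibleS nD => x; apply: contra_not => Dx.
by rewrite /= GF ?inE// Ff.
Qed.

End VariationFunctions.

Section Oscillation.
Context {d : Order.disp_t} {R : realType}.
Context {X : measurableOrderTopologicalType d}.
Implicit Types (C : set X) (W : X -> R) (V : R).

(** On the empty set this is [0], both extrema being [0] by convention. *)
Definition oscillation W C : R := sup (W @` C) - inf (W @` C).

Lemma bounded_image W C V : (forall x, 0 <= W x <= V) ->
  forall x, C x -> inf (W @` C) <= W x <= sup (W @` C).
Proof.
move=> WV x Cx; apply/andP; split.
  by apply: ge_inf; [exists 0 => _ [y _ <-]; case/andP: (WV y)|exists x].
by apply: ub_le_sup; [exists V => _ [y _ <-]; case/andP: (WV y)|exists x].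
Qed.

Lemma oscillation_ge W C V x y : (forall x, 0 <= W x <= V) -> C x -> C y ->
  W y - W x <= oscillation W C.
Proof.
move=> WV Cx Cy; have := bounded_image WV Cx; have := bounded_image WV Cy.
rewrite /oscillation; lra.
Qed.

Lemma oscillation_ge0 W C V : (forall x, 0 <= W x <= V) -> 0 <= oscillation W C.
Proof.
move=> WV; have [->|/set0P[x0 Cx0]] := eqVneq C set0.
  by rewrite /oscillation image_set0 inf0 sup0 subrr.
by rewrite -(subrr (W x0)); exact: (oscillation_ge WV Cx0 Cx0).
Qed.

Definition separated_sets C C' :=
  (forall x y, C x -> C' y -> (x < y)%O) \/ (forall x y, C x -> C' y -> (y < x)%O).

(* The open intervals spanned by the images of the [C i] are disjoint, so that
   their total length is at most the length of [[0, V]]. *)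
Lemma sum_oscillation_le (I : choiceType) (s : seq I) (C : I -> set X) W V :
  uniq s -> {in s &, forall i j, i != j -> separated_sets (C i) (C j)} ->
  {homo W : x y / (x <= y)%O} -> (forall x, 0 <= W x <= V) ->
  \sum_(i <- s) oscillation W (C i) <= V.
Proof.
move=> us sep Wm WV.
have V0 : 0 <= V by have /andP[] := WV point; exact: le_trans.
pose J i : set R := `]inf (W @` C i), sup (W @` C i)[%classic.
have mJ i : measurable (J i) by exact: measurable_itv.
have JP i t : J i t -> exists x y, [/\ C i x, C i y, W x < t & t < W y].
  rewrite /J/= in_itv/= => /andP[it ti].
  have ne : W @` C i !=set0.
    apply/set0P/negP => /eqP e; move: it ti; rewrite e inf0 sup0; lra.
  have hinf : has_inf (W @` C i).
    by split => //; exists 0 => _ [y _ <-]; case/andP: (WV y).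
  have hsup : has_sup (W @` C i).
    by split => //; exists V => _ [y _ <-]; case/andP: (WV y).
  have [_ [x Cx <-] xt] := inf_adherent (eps := t - inf (W @` C i)) ltac:(lra) hinf.
  have [_ [y Cy <-] yt] := sup_adherent (eps := sup (W @` C i) - t) ltac:(lra) hsup.
  by exists x, y; split => //; lra.
have tJ : trivIset [set` s] J.
  apply/trivIsetP => i j /= si sj ij; rewrite -subset0 => t [Jit Jjt].
  have [x [y [Cx Cy xt ty]]] := JP _ _ Jit.
  have [x' [y' [Cx' Cy' xt' ty']]] := JP _ _ Jjt.
  case: (sep _ _ si sj ij) => lt.
    by have := Wm _ _ (ltW (lt _ _ Cy Cx')); lra.
  by have := Wm _ _ (ltW (lt _ _ Cx Cy')); lra.
have sub : \bigcup_(i in [set` s]) J i `<=` `[0, V]%classic.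
  move=> t [i _ /JP [x [y [_ _ xt ty]]]]; rewrite /= in_itv/=.
  by have := WV x; have := WV y; lra.
have mU : measurable (\bigcup_(i in [set` s]) J i).
  by apply: fin_bigcup_measurable => //; exact: finite_seq.
have /= := @le_measure _ _ _ (@lebesgue_measure R) _ _ (mem_set mU)
  (mem_set (measurable_itv `[0, V])) sub.
rewrite measure_fin_bigcup//; last by move=> i _; exact: mJ.
rewrite -fsbig_seq// lebesgue_measure_itv/=.
rewrite (_ : (if _ then _ else _) = V%:E)%E; last first.
  rewrite lte_fin; case: ltP => [_|]; first by rewrite oppr0 adde0.
  by move=> V0'; congr (_%:E); apply/eqP; rewrite eq_le V0 V0'.
rewrite (eq_bigr (fun i => (oscillation W (C i))%:E)) ?sumEFin ?lee_fin//.
move=> i _; have := oscillation_ge0 (C i) WV; rewrite /oscillation subr_ge0 => le.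
rewrite /J lebesgue_measure_itv/= lte_fin; case: ltP => // ge.
by rewrite (_ : sup _ = inf (W @` C i)) ?subrr//; apply/eqP; rewrite eq_le ge le.
Qed.

End Oscillation.

(** * Integrals over disjoint sets and mean values *)

Section Integrals.
Context {dd : measure_display} {Y : measurableType dd} {R : realType}.
Variable mu : {measure set Y -> \bar R}.
Local Open Scope ereal_scope.

Lemma sum_integral_le (I : choiceType) (s : seq I) (C : I -> set Y) (f : Y -> \bar R) :
  uniq s -> trivIset [set` s] C -> (forall i, measurable (C i)) ->
  measurable_fun setT f -> (forall x, 0 <= f x) ->
  \sum_(i <- s) \int[mu]_(x in C i) f x <= \int[mu]_x f x.
Proof.
move=> us tC mC mf f0; rewrite -ge0_integral_bigsetU//; last exact: measurable_funTS.
apply: ge0_subset_integral => //; exact: bigsetU_measurable.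
Qed.

(** Integrates the constant [r] over [C], using that [f'] and [f] agree almost everywhere. With [r]
    a value of [|f'|] and [o] an oscillation, a pointwise value is bounded by a mean. *)
Lemma le_mean_value (C : set Y) (f f' : Y -> R) (o r : R) : measurable C ->
  measurable_fun setT f -> {ae mu, forall x, f' x = f x} -> (0 <= o)%R -> (0 <= r)%R ->
  (forall z, C z -> (r <= `|f' z| + o)%R) ->
  r%:E * mu C <= \int[mu]_(x in C) `|f x|%:E + o%:E * mu C.
Proof.
move=> mC mf ff o0 r0 h; rewrite -!integral_cst//.
have mabs : measurable_fun C (fun x => `|f x|%:E).
  by apply/measurable_EFinP; apply: measurableT_comp => //; exact: measurable_funTS.
rewrite -ge0_integralD//=.
apply: ae_ge0_le_integral => //=.
- by move=> x _; rewrite lee_fin addr_ge0.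
- exact: emeasurable_funD.
by apply: filterS ff => x <- Cx; rewrite -EFinD lee_fin h.
Qed.

End Integrals.

(** * Approximation of unordered sums by finite sums *)

Section SummableApprox.
Context {R : realType} {I : choiceType}.

(** The sum is a supremum over finite sets, and enlarging a finite set brings a nonnegative partial
    sum closer to it. The uniformity in [s'] later allows one list to serve several points at
    once. *)
Lemma esum_approx (u : I -> R) : (forall i, 0 <= u i) ->
  (\esum_(i in setT) (u i)%:E < +oo)%E -> forall e, 0 < e ->
  exists s : seq I, forall s', uniq s' -> {subset s <= s'} ->
    `|fine (\esum_(i in setT) (u i)%:E) - \sum_(i <- s') u i| <= e.
Proof.
move=> u0 uoo e e0.
have uf : (\esum_(i in setT) (u i)%:E \is a fin_num)%E.
  by rewrite ge0_fin_numE//; apply: esum_ge0 => i _; rewrite lee_fin.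
have [_ [A [/finite_seqP[s ->] _] <-]] := ub_ereal_sup_adherent e0 uf.
rewrite -/(esum _ _) => lt.
exists s => s' us' sub.
have le : (\sum_(i \in [set` s]) (u i)%:E <= (\sum_(i <- s') u i)%:E)%E.
  rewrite -sumEFin (fsbig_seq _ _ us'); apply: lee_fsum_nneg_subset => //.
  - by move=> i; rewrite !inE; exact: sub.
  - by move=> i _; rewrite lee_fin.
have ge : ((\sum_(i <- s') u i)%:E <= \esum_(i in setT) (u i)%:E)%E.
  by rewrite -sumEFin (fsbig_seq _ _ us'); apply: ereal_sup_ubound; exists [set` s'].
move: (lt_le_trans lt le) ge; rewrite -[X in (X - _)%E]fineK// -[X in (_ <= X)%E]fineK//.
by rewrite -EFinB lte_fin lee_fin => lt1 ge; rewrite ger0_norm; lra.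
Qed.

Lemma summable_approx (u : I -> R) : summable setT (EFin \o u) -> forall e, 0 < e ->
  exists s : seq I, forall s', uniq s' -> {subset s <= s'} ->
    `|fine (\esum_(i in setT) (EFin \o u)^\+ i - \esum_(i in setT) (EFin \o u)^\- i)%E
      - \sum_(i <- s') u i| <= e.
Proof.
move=> su e e0.
have pE i : (EFin \o u)^\+%E i = (Num.max (u i) 0)%:E by rewrite funeposE/= EFin_max.
have nE i : (EFin \o u)^\-%E i = (Num.max (- u i) 0)%:E by rewrite funenegE/= EFin_max.
have pos := summable_funepos su; have neg := summable_funeneg su.
rewrite /summable in pos neg.
rewrite (eq_esum (fun i _ => pE i)) (eq_esum (fun i _ => nE i)).
rewrite (eq_esum (b := fun i => (Num.max (u i) 0)%:E)) in pos; last first.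
  by move=> i _; rewrite pE gee0_abs ?lee_fin ?le_max ?lexx ?orbT.
rewrite (eq_esum (b := fun i => (Num.max (- u i) 0)%:E)) in neg; last first.
  by move=> i _; rewrite nE gee0_abs ?lee_fin ?le_max ?lexx ?orbT.
have e2 : 0 < e / 2 by lra.
have [|s1 h1] := esum_approx _ pos e2; first by move=> i; rewrite le_max lexx orbT.
have [|s2 h2] := esum_approx _ neg e2; first by move=> i; rewrite le_max lexx orbT.
exists (s1 ++ s2) => s' us' sub.
have {}h1 := h1 s' us' (fun i si => sub i ltac:(by rewrite mem_cat si)).
have {}h2 := h2 s' us' (fun i si => sub i ltac:(by rewrite mem_cat si orbT)).
rewrite fineB; last 2 first.
- by rewrite ge0_fin_numE//; apply: esum_ge0 => i _; rewrite lee_fin le_max lexx orbT.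
- by rewrite ge0_fin_numE//; apply: esum_ge0 => i _; rewrite lee_fin le_max lexx orbT.
have -> : \sum_(i <- s') u i =
    \sum_(i <- s') Num.max (u i) 0 - \sum_(i <- s') Num.max (- u i) 0.
  rewrite -sumrB; apply: eq_bigr => i _.
  by case: (leP (u i) 0); case: (leP (- u i) 0); lra.
move: h1 h2; rewrite !ler_norml; lra.
Qed.

End SummableApprox.

(** * Branches and their inverses *)

Section BranchInverse.
Context {d : Order.disp_t} {X : orderTopologicalType d}.
Implicit Types (T : X -> X) (u v x y z : X).

Lemma nbhs_lray u v : (u < v)%O -> nbhs u [set z : X | (z < v)%O].
Proof.
move=> uv; have -> : [set z : X | (z < v)%O] = [set` `]-oo, v[].
  by apply/seteqP; split => z /=; rewrite in_itv.
by apply: open_nbhs_nbhs; split; [exact: lray_open|rewrite /= in_itv].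
Qed.

Lemma nbhs_rray u v : (v < u)%O -> nbhs u [set z : X | (v < z)%O].
Proof.
move=> uv; have -> : [set z : X | (v < z)%O] = [set` `]v, +oo[].
  by apply/seteqP; split => z /=; rewrite in_itv/= ?andbT.
by apply: open_nbhs_nbhs; split; [exact: rray_open|rewrite /= in_itv/= uv].
Qed.

Lemma ooIP u v z : ooI u v z <-> (u < z)%O /\ (z < v)%O.
Proof. by rewrite /ooI/= in_itv/=; split => [/andP|[-> ->]]. Qed.

Lemma ccIP u v z : ccI u v z <-> (u <= z)%O /\ (z <= v)%O.
Proof. by rewrite /ccI/= in_itv/=; split => [/andP|[-> ->]]. Qed.

Lemma ooI_ccI u v : ooI u v `<=` ccI u v.
Proof. by move=> z /ooIP[uz zv]; apply/ccIP; split; exact: ltW. Qed.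

Lemma ccI_split u v z : ccI u v z -> [\/ z = u, z = v | ooI u v z].
Proof.
move=> /ccIP[]; rewrite !le_eqVlt => /predU1P[->|uz]; first by constructor 1.
by move=> /predU1P[->|zv]; [constructor 2|constructor 3; exact/ooIP].
Qed.

(** The closure condition is used twice: a first point [z] of [I] beyond [p.1] may be an endpoint,
    but a second one strictly between [p.1] and [z] is interior to the interval. *)
Lemma tail_ooI I p u v (U : set X) : (u < v)%O -> I `<=` ccI u v -> tail_mem I p ->
  nbhs p.1 U -> exists z, [/\ U z, I z, side p z & ooI u v z].
Proof.
move=> uv sI [Ip cl] nU.
have /cl[z [[Iz sz] Uz]] : nbhs p.1 U by [].
have [z' [Uz' Iz' sz' zz']] : exists z', [/\ U z', I z', side p z' &
    if p.2 then (z' < z)%O else (z < z')%O].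
  have : nbhs p.1 (U `&` [set z' | if p.2 then (z' < z)%O else (z < z')%O]).
    apply: filterI => //; move: sz; rewrite /side/=.
    by case: p.2 => sz; [exact: nbhs_lray|exact: nbhs_rray].
  by move=> /cl[z' [[Iz' sz'] [Uz' zz']]]; exists z'.
have [pu pv] : (u <= p.1)%O /\ (p.1 <= v)%O by apply/ccIP/sI.
have [zu zv] : (u <= z)%O /\ (z <= v)%O by apply/ccIP/sI.
exists z'; split => //; apply/ooIP; move: sz sz' zz'; rewrite /side/=.
case: p.2 => sz sz' zz'; split.
- exact: le_lt_trans sz'.
- exact: lt_le_trans zv.
- exact: le_lt_trans zz'.
- exact: lt_le_trans pv.
Qed.

Lemma branch_tail T u v : branch T u v ->
  [/\ (u < v)%O, tail_mem (ccI u v) (u, true) & tail_mem (ccI u v) (v, false)].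
Proof. by case. Qed.

Lemma tail_memS (I J : set X) p : I `<=` J -> tail_mem I p -> tail_mem J p.
Proof.
move=> IJ [Ip cl]; split; first exact: IJ.
by apply: closureS cl => z [Iz sz]; split => //; exact: IJ.
Qed.

Lemma branch_ooI_nbhs T u v (U : set X) : branch T u v ->
  nbhs u U \/ nbhs v U -> exists2 z, U z & ooI u v z.
Proof.
move=> /branch_tail[uv tu tv] [nU|nU].
  by have [z [Uz _ _ oz]] := tail_ooI uv (@subset_refl _ _) tu nU; exists z.
by have [z [Uz _ _ oz]] := tail_ooI uv (@subset_refl _ _) tv nU; exists z.
Qed.

(** Otherwise the second open interval would be a neighbourhood of an endpoint of the first, and
    would meet its interior. *)
Lemma branch_disjoint T u v u' v' : branch T u v ->
  ooI u v `&` ooI u' v' = set0 -> ~ ooI u' v' u /\ ~ ooI u' v' v.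
Proof.
move=> hT; rewrite -subset0 => h0.
have op w : ooI u' v' w -> nbhs w (ooI u' v').
  by move=> ow; apply: open_nbhs_nbhs; split => //; exact: itv_open.
split => [/op nU|/op nU].
  have [z Uz oz] := branch_ooI_nbhs hT (or_introl nU); exact: (h0 z).
have [z Uz oz] := branch_ooI_nbhs hT (or_intror nU); exact: (h0 z).
Qed.

(** Interior points of the first interval close enough to a common left or right endpoint would also
    be interior to the second. *)
Lemma branch_endpoint_inj T u v u' v' : branch T u v -> branch T u' v' ->
  ooI u v `&` ooI u' v' = set0 -> u <> u' /\ v <> v'.
Proof.
move=> hT hT'; rewrite -subset0 => h0.
have [uv _ _] := branch_tail hT; have [uv' _ _] := branch_tail hT'.
split => e.
  have [|z /= zv' /ooIP[uz zv]] := branch_ooI_nbhs (U := [set z | (z < v')%O]) hT.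
    by left; rewrite e; exact: nbhs_lray.
  by apply: (h0 z); split; apply/ooIP => //; rewrite -e.
have [|z /= zu' /ooIP[uz zv]] := branch_ooI_nbhs (U := [set z | (u' < z)%O]) hT.
  by right; rewrite e; exact: nbhs_rray.
by apply: (h0 z); split; apply/ooIP => //; rewrite -e.
Qed.

(** Supplies the limits required of a hanging point: beside an endpoint [T] agrees with [Tn], which
    is continuous up to the endpoint. *)
Lemma branch_cvg T Tn u v : (u < v)%O -> (forall x, ooI u v x -> Tn x = T x) ->
  {within ccI u v, continuous Tn} ->
  T @ one_sided (u, true) --> Tn u /\ T @ one_sided (v, false) --> Tn v.
Proof.
move=> uv eT /subspace_continuousP cT; split.
  have /cT cu : ccI u v u by apply/ccIP; split => //; exact: ltW.
  move=> P /cu; rewrite /one_sided /= !nbhs_simpl /within/= => h.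
  near=> z => uz; rewrite /= -eT; last first.
    by apply/ooIP; split => //; near: z; exact: nbhs_lray.
  apply: (near h z) => //; apply/ccIP; split; first exact: ltW.
  by apply/ltW; near: z; exact: nbhs_lray.
have /cT cv : ccI u v v by apply/ccIP; split => //; exact: ltW.
move=> P /cv; rewrite /one_sided /= !nbhs_simpl /within/= => h.
near=> z => zv; rewrite /= -eT; last first.
  by apply/ooIP; split => //; near: z; exact: nbhs_rray.
apply: (near h z) => //; apply/ccIP; split; last exact: ltW.
by apply/ltW; near: z; exact: nbhs_rray.
Unshelve. all: by end_near. Qed.

(* The inverse of a branch, extended to the whole space by the endpoints that are
   mapped to the extremities of its range. *)
Lemma branch_inverse T u v aX bX : (forall x, (aX <= x <= bX)%O) -> branch T u v ->
  exists y : X -> X,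
  [/\ forall x, ccI u v (y x),
      {homo y : x x' / (x <= x')%O} \/ {homo y : x x' / (x <= x')%O >-> (x' <= x)%O},
      forall x, ooI u v (y x) -> T (y x) = x,
      forall z, ooI u v z -> y (T z) = z
    & forall x, x <> aX -> x <> bX ->
      (y x = u -> exists l, [/\ T @ one_sided (u, true) --> l, l <> aX & l <> bX]) /\
      (y x = v -> exists l, [/\ T @ one_sided (v, false) --> l, l <> aX & l <> bX])].
Proof.
move=> bnd [uv _ _ _ [Tn [Sn [eT [cTn _] SnTn mon [u' [v' im]]]]]].
have [cu cv] : ccI u v u /\ ccI u v v by split; apply/ccIP; split => //; exact: ltW.
have imS x : (u' <= x)%O -> (x <= v')%O -> ccI u v (Sn x) /\ Tn (Sn x) = x.
  move=> ux xv; have : ccI u' v' x by apply/ccIP.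
  by rewrite -im => -[z cz <-]; rewrite SnTn.
have imT z : ccI u v z -> (u' <= Tn z)%O /\ (Tn z <= v')%O.
  by move=> cz; apply/ccIP; rewrite -im; exists z.
have uv' : (u' <= v')%O by have [] := imT _ cu; exact: le_trans.
(* [lo] and [hi] are [u] and [v] for an increasing branch and [v] and [u] for a decreasing one, so
   that the rest of the construction treats both at once. *)
have [lo [hi [clo chi Tlo Thi [mSn oo lh]]]] : exists lo hi, [/\ ccI u v lo, ccI u v hi,
    Tn lo = u', Tn hi = v' &
    [/\ (forall x x', (u' <= x)%O -> (x <= x')%O -> (x' <= v')%O ->
         (Sn x <= Sn x')%O) /\ (forall z, ccI u v z -> (lo <= z)%O /\ (z <= hi)%O) \/
        (forall x x', (u' <= x)%O -> (x <= x')%O -> (x' <= v')%O ->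
         (Sn x' <= Sn x)%O) /\ (forall z, ccI u v z -> (z <= lo)%O /\ (hi <= z)%O),
      (forall z, ooI u v z -> (u' < Tn z)%O /\ (Tn z < v')%O) &
      (u' < v')%O /\ forall z, ooI u v z -> z <> lo /\ z <> hi]].
  have [cSu eSu] := imS _ (lexx u') uv'.
  have [cSv eSv] := imS _ uv' (lexx v').
  case: mon => [inc|dec].
    have inc' x y : ccI u v x -> ccI u v y -> (x <= y)%O -> (Tn x <= Tn y)%O.
      by move=> cx cy; rewrite le_eqVlt => /predU1P[->//|/inc h]; apply/ltW/h.
    have Tu : Tn u = u'.
      apply/eqP; rewrite eq_le (imT _ cu).1 andbT -eSu; apply: inc' => //.
      by case/ccIP: cSu.
    have Tv : Tn v = v'.
      apply/eqP; rewrite eq_le (imT _ cv).2/= -{1}eSv; apply: inc' => //.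
      by case/ccIP: cSv.
    exists u, v; split => //; split.
    - left; split; last by move=> z /ccIP.
      move=> x x' ux xx' xv; have [cx ex] := imS _ ux (le_trans xx' xv).
      have [cx' ex'] := imS _ (le_trans ux xx') xv.
      by rewrite leNgt; apply/negP => /inc; rewrite ex ex' ltNge xx' => /(_ cx' cx).
    - move=> z oz; have cz := ooI_ccI oz; case/ooIP: oz => uz zv.
      by rewrite -Tu -Tv; split; apply: inc.
    - split; first by rewrite -Tu -Tv; exact: inc.
      by move=> z /ooIP[uz zv]; split=> e; move: uz zv; rewrite e ltxx.
  have dec' x y : ccI u v x -> ccI u v y -> (x <= y)%O -> (Tn y <= Tn x)%O.
    by move=> cx cy; rewrite le_eqVlt => /predU1P[->//|/dec h]; apply/ltW/h.
  have Tv : Tn v = u'.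
    apply/eqP; rewrite eq_le (imT _ cv).1 andbT -eSu; apply: dec' => //.
    by case/ccIP: cSu.
  have Tu : Tn u = v'.
    apply/eqP; rewrite eq_le (imT _ cu).2/= -{1}eSv; apply: dec' => //.
    by case/ccIP: cSv.
  exists v, u; split => //; split.
  - right; split; last by move=> z /ccIP[].
    move=> x x' ux xx' xv; have [cx ex] := imS _ ux (le_trans xx' xv).
    have [cx' ex'] := imS _ (le_trans ux xx') xv.
    by rewrite leNgt; apply/negP => /dec; rewrite ex ex' ltNge xx' => /(_ cx cx').
  - move=> z oz; have cz := ooI_ccI oz; case/ooIP: oz => uz zv.
    by rewrite -Tu -Tv; split; apply: dec.
  - split; first by rewrite -Tu -Tv; exact: dec.
    by move=> z /ooIP[uz zv]; split=> e; move: uz zv; rewrite e ltxx.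
pose y x := if (x <= u')%O then lo else if (v' <= x)%O then hi else Sn x.
have yP x : [\/ (x <= u')%O /\ y x = lo,
    [/\ (v' <= x)%O, (u' < x)%O & y x = hi] | [/\ (u' < x)%O, (x < v')%O & y x = Sn x]].
  rewrite /y; case: leP => [xu|ux]; first by constructor 1.
  by case: leP => [vx|xv]; [constructor 2|constructor 3].
have cy x : ccI u v (y x).
  case: (yP x) => [[_ ->]//|[_ _ ->]//|[ux xv ->]].
  by have [] := imS _ (ltW ux) (ltW xv).
exists y; split => //.
- case: mSn => -[mSn lz]; [left|right] => x x' xx'.
    case: (yP x) => [[xu ->]|[vx ux ->]|[ux xv ->]].
    + by have [] := lz _ (cy x').
    + case: (yP x') => [[xu _]|[_ _ ->]//|[_ xv _]].
        by have := lt_le_trans ux (le_trans xx' xu); rewrite ltxx.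
      by have := le_lt_trans (le_trans vx xx') xv; rewrite ltxx.
    + case: (yP x') => [[xu _]|[_ _ ->]|[ux' xv' ->]].
      * by have := lt_le_trans ux (le_trans xx' xu); rewrite ltxx.
      * by have [cS _] := imS _ (ltW ux) (ltW xv); have [] := lz _ cS.
      * by apply: mSn => //; exact: ltW.
  case: (yP x) => [[xu ->]|[vx ux ->]|[ux xv ->]].
  + by have [] := lz _ (cy x').
  + case: (yP x') => [[xu _]|[_ _ ->]//|[_ xv _]].
      by have := lt_le_trans ux (le_trans xx' xu); rewrite ltxx.
    by have := le_lt_trans (le_trans vx xx') xv; rewrite ltxx.
  + case: (yP x') => [[xu _]|[_ _ ->]|[ux' xv' ->]].
    * by have := lt_le_trans ux (le_trans xx' xu); rewrite ltxx.
    * by have [cS _] := imS _ (ltW ux) (ltW xv); have [] := lz _ cS.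
    * by apply: mSn => //; exact: ltW.
- move=> x oy; rewrite -eT//; case: (yP x) oy => [[_ ->] /lh.2[]//|[_ _ ->] /lh.2[]//|].
  by move=> [ux xv ->] _; have [] := imS _ (ltW ux) (ltW xv).
- move=> z oz; have [lt1 lt2] := oo _ oz.
  rewrite /y -eT// (lt_geF lt1) (lt_geF lt2); exact/SnTn/ooI_ccI.
move=> x xa xb.
have ax : (aX < x)%O by rewrite lt_neqAle (proj1 (andP (bnd x))) andbT; apply/eqP => /esym.
have xb' : (x < bX)%O by rewrite lt_neqAle (proj2 (andP (bnd x))) andbT; exact/eqP.
(* If [y x = lo] because [x <= u'], then [aX < x <= u' < v' <= bX], so [Tn lo = u'] is neither
   bound; the case [v' <= x] is symmetric. Inside the range [Tn (y x)] is [x] itself. *)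
have key : Tn (y x) <> aX /\ Tn (y x) <> bX.
  case: (yP x) => [[xu ->]|[vx _ ->]|[ux xv ->]].
  - rewrite Tlo; split => [e|e]; first by move: (lt_le_trans ax xu); rewrite e ltxx.
    by have := lh.1; rewrite e ltNge; have /andP[_ ->] := bnd v'.
  - rewrite Thi; split => [e|e]; last by move: (le_lt_trans vx xb'); rewrite e ltxx.
    by have := lh.1; rewrite e ltNge; have /andP[-> _] := bnd u'.
  - by have [_ ->] := imS _ (ltW ux) (ltW xv).
have [c1 c2] := branch_cvg uv eT cTn.
split => e; [exists (Tn u)|exists (Tn v)]; move: key; rewrite e => -[? ?].
  by split.
by split.
Qed.

End BranchInverse.

(** * Variation of a weighted function along an inverse branch *)

Section BranchVariation.
Context {d : Order.disp_t} {R : realType}.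
Context {X : measurableOrderTopologicalType d}.
Implicit Types (u v x z : X) (g f W : X -> R) (V G K : R).

(** The product rule can be written with [g] evaluated at either end. Hence [g <= G] is needed at
    one end only, which matters because [G] will be an essential bound that can fail at auxiliary
    points. *)
Lemma product_dominated f g Wf Wg G K C : (forall z, 0 <= g z) ->
  dominates C Wf f -> dominates C Wg g -> (forall z, C z -> `|f z| <= K) ->
  forall y y', C y -> C y' -> (y <= y')%O -> g y <= G \/ g y' <= G ->
  `|g y' * f y' - g y * f y| <= (G * Wf y' + K * Wg y') - (G * Wf y + K * Wg y).
Proof.
move=> g0 df dg fK y y' Cy Cy' yy' gG.
have hf := df _ _ Cy Cy' yy'; have hg := dg _ _ Cy Cy' yy'.
have red a b : `|a| <= K -> b <= G -> 0 <= b ->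
    g y' * f y' - g y * f y = a * (g y' - g y) + b * (f y' - f y) ->
    `|g y' * f y' - g y * f y| <= (G * Wf y' + K * Wg y') - (G * Wf y + K * Wg y).
  move=> aK bG b0 ->; rewrite (le_trans (ler_normD _ _))// !normrM (ger0_norm b0).
  have h1 : `|a| * `|g y' - g y| <= K * (Wg y' - Wg y) by exact: ler_pM.
  have h2 : b * `|f y' - f y| <= G * (Wf y' - Wf y) by exact: ler_pM.
  lra.
by case: gG => gG; [apply: (red (f y') (g y))|apply: (red (f y) (g y'))] => //;
  [exact: fK|ring|exact: fK|ring].
Qed.

(** The control is composed with [y]. Where [y] takes an endpoint as value the product is [0], and
    the jump to its interior values is bounded by [ju] or [jv], its approximate size at suitable
    points near that endpoint. *)
Lemma branch_dominated u v f g Wf V G K (Vg ju jv : R) (y : X -> X) (D : set X) :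
  (u < v)%O -> ooI u v !=set0 ->
  (forall x, 0 <= Wf x <= V) -> dominates setT Wf f ->
  0 <= G -> 0 <= K -> 0 <= Vg -> 0 <= ju -> 0 <= jv ->
  (pointwise_variation (ooI u v) g <= Vg%:E)%E ->
  (forall x, 0 <= g x) -> g u = 0 -> g v = 0 ->
  (forall z, ooI u v z -> `|f z| <= K) ->
  {homo y : x x' / (x <= x')%O} \/ {homo y : x x' / (x <= x')%O >-> (x' <= x)%O} ->
  (forall x, ccI u v (y x)) ->
  (forall x, D x -> ooI u v (y x) -> g (y x) <= G) ->
  (forall x, D x -> y x = u -> forall t eps, ooI u v t -> 0 < eps ->
    exists z, [/\ ooI u v z, (z <= t)%O & g z * `|f z| <= ju + eps]) ->
  (forall x, D x -> y x = v -> forall t eps, ooI u v t -> 0 < eps ->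
    exists z, [/\ ooI u v z, (t <= z)%O & g z * `|f z| <= jv + eps]) ->
  exists W, dominates D W (fun x => g (y x) * f (y x)) /\
    forall x x', D x -> D x' ->
      W x' - W x <= G * oscillation Wf (ooI u v) + K * Vg + ju + jv.
Proof.
move=> uv [z0 oz0] WV df G0 K0 Vg0 ju0 jv0 hVg
  g0 gu gv fK ym cy gG hu hv.
have [Wg [WgV _ dg]] := variation_function Vg0 hVg.
have {}df : dominates (ooI u v) Wf f by move=> *; apply: df.
pose w z := G * Wf z + K * Wg z.
have prod := product_dominated (G := G) g0 df dg fK.
set m := inf (Wf @` ooI u v); set M := sup (Wf @` ooI u v).
have mM z : ooI u v z -> m <= Wf z <= M by apply: bounded_image WV z.
have wlo z : ooI u v z -> G * m <= w z.
  move=> oz; rewrite /w; have /andP[Wg0 _] := WgV z; have /andP[mW _] := mM _ oz.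
  by have := ler_wpM2l G0 mW; have := mulr_ge0 K0 Wg0; lra.
have whi z : ooI u v z -> w z <= G * M + K * Vg.
  move=> oz; rewrite /w; have /andP[_ Wg1] := WgV z; have /andP[_ WM] := mM _ oz.
  by have := ler_wpM2l G0 WM; have := ler_wpM2l K0 Wg1; lra.
(* [w] controls the product on the interior. Its bounds there, moved outwards by [ju] and [jv], are
   taken as values at the endpoints, which leaves room for the jumps and fixes the total
   increase. *)
pose om z := if z == u then G * m - ju else if z == v then G * M + K * Vg + jv else w z.
have omu : om u = G * m - ju by rewrite /om eqxx.
have omv : om v = G * M + K * Vg + jv by rewrite /om eqxx gt_eqF.
have omo z : ooI u v z -> om z = w z.
  by move=> /ooIP[uz zv]; rewrite /om gt_eqF// lt_eqF.
have lo_hi : G * m <= G * M + K * Vg by have := wlo _ oz0; have := whi _ oz0; lra.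
have omlo z : ccI u v z -> om u <= om z.
  move=> /ccI_split[->|->|oz]; rewrite ?omu ?omv ?(omo _ oz); try lra.
  by have := wlo _ oz; lra.
have omhi z : ccI u v z -> om z <= om v.
  move=> /ccI_split[->|->|oz]; rewrite ?omu ?omv ?(omo _ oz); try lra.
  by have := whi _ oz; lra.
have tot x x' : om (y x') - om (y x) <= G * oscillation Wf (ooI u v) + K * Vg + ju + jv.
  have := omlo _ (cy x); have := omhi _ (cy x'); rewrite omu omv.
  have -> : oscillation Wf (ooI u v) = M - m by [].
  lra.
have key x x' : D x -> D x' -> (y x <= y x')%O ->
    `|g (y x') * f (y x') - g (y x) * f (y x)| <= om (y x') - om (y x).
  move=> Dx Dx' yy'; case/ccI_split: (cy x) => [e|e|ox].
  - rewrite e gu mul0r subr0; case/ccI_split: (cy x') => [e'|e'|ox'].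
    + by rewrite e' gu mul0r normr0 subrr.
    + rewrite e' gv mul0r normr0 subr_ge0; apply: omlo.
      by apply/ccIP; split => //; exact: ltW.
    (* The jump from [0] is split at a point [z] near [u]: the product is at most [ju + eps] at [z],
       and the product rule applies from [z] to [y x']. *)
    + rewrite omu (omo _ ox'); apply/ler_addgt0Pr => eps eps0.
      have [z [oz zt hz]] := hu x Dx e _ _ ox' eps0.
      have := prod _ _ oz ox' zt (or_intror (gG _ Dx' ox')); rewrite -/(w z) -/(w (y x')).
      have := ler_normD (g z * f z) (g (y x') * f (y x') - g z * f z).
      rewrite [X in `|X|]addrC subrK [`|g z * f z|]normrM (ger0_norm (g0 z)).
      have := wlo _ oz; lra.
  - have -> : y x' = v.
      by apply/eqP; rewrite eq_le -{2}e yy' andbT; case/ccIP: (cy x').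
    by rewrite e gv mul0r !subrr normr0.
  - case/ccI_split: (cy x') => [e'|e'|ox'].
    + have ux : (u < y x)%O by case/ooIP: ox.
      by move: (lt_le_trans ux yy'); rewrite e' ltxx.
    + rewrite e' gv mul0r sub0r normrN omv (omo _ ox); apply/ler_addgt0Pr => eps eps0.
      have [z [oz tz hz]] := hv x' Dx' e' _ _ ox eps0.
      have := prod _ _ ox oz tz (or_introl (gG _ Dx ox)); rewrite -/(w z) -/(w (y x)).
      have := ler_normB (g z * f z) (g z * f z - g (y x) * f (y x)).
      rewrite subKr [`|g z * f z|]normrM (ger0_norm (g0 z)).
      have := whi _ oz; lra.
    + by rewrite (omo _ ox) (omo _ ox'); apply: prod => //; left; exact: gG.
case: ym => ym.
  exists (om \o y); split => [x x' Dx Dx' xx'|x x' _ _]; last exact: tot.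
  by apply: key => //; exact: ym.
exists (fun x => - om (y x)); split => [x x' Dx Dx' xx'|x x' _ _].
  by rewrite distrC opprK [leRHS]addrC; apply: key => //; exact: ym.
by rewrite opprK addrC; exact: tot.
Qed.

End BranchVariation.

(** * Families of intervals with disjoint interiors *)

Section Cores.
Context {d : Order.disp_t} {X : orderTopologicalType d} {I : choiceType} (c e : I -> X).

(* Two intervals with disjoint non-empty interiors may share endpoints, and even
   two points when X has a jump; the cores are disjoint. *)
Definition core (m : I) : set X :=
  ccI (c m) (e m) `\` \bigcup_(k in [set k | k != m]) ccI (c k) (e k).

Lemma core_disjoint m k : m != k -> core m `&` core k = set0.
Proof.
move=> mk; rewrite -subset0 => x [[Jx _] [_ nx]]; apply: nx.
by exists m.
Qed.

(** If [y <= x], then [c m <= c k <= y <= x <= e m], so that [y] would lie in the m-th interval,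
    which the k-th core excludes. *)
Lemma core_separated m k : m != k -> forall x y, core m x -> core k y ->
  (c m <= c k)%O -> (x < y)%O.
Proof.
move=> mk x y [/ccIP[mx xm] nx] [/ccIP[ky yk] ny] ck.
rewrite ltNge; apply/negP => yx.
have kx : (e k < x)%O.
  rewrite ltNge; apply/negP => xk; apply: nx; exists k; first by rewrite /= eq_sym.
  by apply/ccIP; split => //; exact: le_trans yx.
have my : (e m < y)%O.
  rewrite ltNge; apply/negP => ym; apply: ny; exists m => //.
  by apply/ccIP; split => //; exact: le_trans ky.
by have := lt_le_trans my (le_trans yx xm); rewrite ltxx.
Qed.

Hypothesis disj : forall m k, m <> k ->
  (ccI (c m) (e m))° `&` (ccI (c k) (e k))° = set0.

Lemma ooI_interior u v : ooI u v `<=` (ccI u v : set X)°.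
Proof.
move=> x ox; apply: (filterS (@ooI_ccI _ _ _ _)).
by apply: open_nbhs_nbhs; split => //; exact: itv_open.
Qed.

Lemma overlap_endpoint m k x : m != k -> ccI (c m) (e m) x -> ccI (c k) (e k) x ->
  [\/ x = c m, x = e m, x = c k | x = e k].
Proof.
move=> mk /ccI_split[->|->|om]; [by constructor|by constructor|].
case/ccI_split => [->|->|ok]; [by constructor|by constructor|].
have : ((ccI (c m) (e m))° `&` (ccI (c k) (e k))°) x.
  by split; exact: ooI_interior.
by rewrite disj//; exact/eqP.
Qed.

End Cores.

Section FiniteCores.
Context {d : Order.disp_t} {X : orderTopologicalType d} {I : finType} (c e : I -> X).
Hypothesis disj : forall m k, m <> k ->
  (ccI (c m) (e m))° `&` (ccI (c k) (e k))° = set0.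

Lemma nbhs_neq (x w : X) : w != x -> nbhs x [set z | z != w].
Proof.
rewrite neq_lt => /orP[wx|xw].
  by apply: filterS (nbhs_rray wx) => z /= /gt_eqF->.
by apply: filterS (nbhs_lray xw) => z /= /lt_eqF->.
Qed.

(** There are finitely many endpoints, so a neighbourhood of [p.1] avoids those different from it. A
    point of [J_m] found there on the side of [p] is no endpoint at all, and a point shared with
    another interval would be one. *)
Lemma core_tail m p (U : set X) : tail_mem (ccI (c m) (e m)) p -> nbhs p.1 U ->
  exists z, [/\ U z, side p z & core c e m z].
Proof.
move=> [Jp cl] nU.
have : nbhs p.1 (U `&` [set z | forall k, (c k != p.1 -> z != c k) /\
                                        (e k != p.1 -> z != e k)]).
  apply: filterI => //; apply: filter_forall => k; apply: filterI.
    by have [->|ck] := eqVneq (c k) p.1; [exact: nearW|apply: filterS (nbhs_neq ck)].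
  by have [->|ek] := eqVneq (e k) p.1; [exact: nearW|apply: filterS (nbhs_neq ek)].
move=> /cl[z [[Jz sz] [Uz hz]]]; exists z; split => //; split => // -[k /= km Jk].
have zp : z != p.1.
  by move: sz; rewrite /side/=; case: p.2 => sz; [rewrite gt_eqF|rewrite lt_eqF].
have nc l : z <> c l.
  by move=> zc; have := (hz l).1; rewrite -zc => /(_ zp); rewrite eqxx.
have ne l : z <> e l.
  by move=> ze; have := (hz l).2; rewrite -ze => /(_ zp); rewrite eqxx.
have mk : m != k by rewrite eq_sym.
by case: (overlap_endpoint disj mk Jz Jk) => //; [exact: nc|exact: ne|exact: nc|exact: ne].
Qed.

End FiniteCores.

Section CoreMeasure.
Context {d : Order.disp_t} {R : realType} {X : measurableOrderTopologicalType d}.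
Context {I : countType} (c e : I -> X) (mu : {measure set X -> \bar R}).
Hypothesis mopen : forall U : set X, open U -> measurable U.

Lemma measurable_ccI (u v : X) : measurable (ccI u v).
Proof.
rewrite -[ccI u v]setCK; apply: measurableC; apply: mopen.
by rewrite openC; exact: itv_closed.
Qed.

Lemma measurable_ooI (u v : X) : measurable (ooI u v).
Proof. by apply: mopen; exact: itv_open. Qed.

Lemma measurable_core m : measurable (core c e m).
Proof.
apply: measurableD; first exact: measurable_ccI.
rewrite bigcup_mkcond; apply: countable_bigcupT_measurable => [|k]; first exact: countableP.
  by case: ifP => // _; exact: measurable_ccI.
Qed.

Lemma countable_negligible_bigcup {J : countType} (F : J -> set X) :
  (forall j, mu.-negligible (F j)) -> mu.-negligible (\bigcup_j F j).
Proof.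
move=> nF; pose G n := if unpickle n is Some j then F j else set0.
apply: (negligibleS (A := \bigcup_n G n)).
  by move=> x [j _ Fx]; exists (pickle j) => //; rewrite /G pickleK.
apply: negligible_bigcup => n; rewrite /G; case: unpickle => // .
exact: negligible_set0.
Qed.

Hypothesis null : forall m k, m <> k -> mu (ccI (c m) (e m) `&` ccI (c k) (e k)) = 0%E.

(** Only a countable union of null overlaps is removed. *)
Lemma measure_core m : mu (core c e m) = mu (ccI (c m) (e m)).
Proof.
set U := \bigcup_(k in [set k | k != m]) ccI (c k) (e k).
have mU : measurable U.
  rewrite /U bigcup_mkcond; apply: countable_bigcupT_measurable => [|k]; first exact: countableP.
  by case: ifP => // _; exact: measurable_ccI.
rewrite [RHS](measureDI _ (measurable_ccI _ _) mU) [X in (_ + X)%E](_ : _ = 0%E) ?adde0//.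
apply: measure_negligible; first by apply: measurableI => //; exact: measurable_ccI.
apply: (negligibleS
  (A := \bigcup_k (if k != m then ccI (c m) (e m) `&` ccI (c k) (e k) else set0))).
  by move=> x [xm [k /= km xk]]; exists k => //=; rewrite km.
apply: countable_negligible_bigcup => k; case: eqVneq => km; last first.
  apply/negligibleP; first by apply: measurableI; exact: measurable_ccI.
  by apply: null => mk; rewrite mk eqxx in km.
exact: negligible_set0.
Qed.

End CoreMeasure.

(** * The transfer operator *)

Section Transfer.
Context {d : Order.disp_t} {R : realType} {X : measurableOrderTopologicalType d}.
Implicit Types (T : X -> X) (g f : X -> R).

(** Turns a sum over a fibre into a sum over branches: each [O n] holds at most one point of the
    fibre, namely [y n], and the weight vanishes at everything left over on either side. *)
Lemma esum_sections (Y I : choiceType) (A : set Y) (O : I -> set Y) (y : I -> Y)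
    (w : Y -> \bar R) :
  (forall n, O n (y n) -> A (y n)) -> (forall n z, O n z -> A z -> y n = z) ->
  (forall n m, n <> m -> O n `&` O m = set0) ->
  (forall z, A z -> (forall n, ~ O n z) -> w z = 0%E) ->
  (forall n, ~ O n (y n) -> w (y n) = 0%E) ->
  (\esum_(z in A) w z = \esum_(n in setT) w (y n))%E.
Proof.
move=> OA yO O0 w0 wy0.
transitivity (\esum_(z in A `&` \bigcup_n O n) w z)%E.
  rewrite esum_mkcondr; apply: eq_esum => z Az; case: ifPn => //.
  rewrite notin_setE => nO; apply: w0 => // n On; apply: nO; exists n => //.
rewrite (@reindex_esum _ _ _ [set n | O n (y n)] _ y).
  rewrite esum_mkcond; apply: eq_esum => n _; case: ifPn => //.
  by rewrite notin_setE => nO; rewrite wy0.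
split.
- by move=> n /= On; split; [exact: OA|exists n].
- move=> n m; rewrite !inE /= => On Om e; apply: contrapT => nm.
  have : (O n `&` O m) (y n) by split => //; rewrite e.
  by rewrite O0.
- move=> z [Az [n _ On]]; exists n; last exact: yO.
  by rewrite /= (yO n z).
Qed.

(** The transfer of the indicator of [A] is nonnegative with integral [mu A = 0], so it vanishes
    almost everywhere, and with it every term of the fibre sum. *)
Lemma transfer_null (mu : probability X R) T g (A : set X) :
  transfer_preserves mu T g -> (forall x, 0 <= g x) -> measurable A -> mu A = 0%E ->
  {ae mu, forall x, forall y, A y -> T y = x -> g y = 0}.
Proof.
move=> hT g0 mA A0.
have iA : mu.-integrable setT (EFin \o \1_A) by exact: integrable_indic.
have [hs hi hint] := hT _ iA.
have u0 y : (0 <= (g y * \1_A y)%:E)%E.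
  by rewrite lee_fin mulr_ge0// indicE.
have tE x : transfer T g \1_A x = fine (\esum_(y in T @^-1` [set x]) (g y * \1_A y)%:E)%E.
  rewrite /transfer; congr fine.
  rewrite [X in (_ - X)%E]esum1 ?sube0.
    apply: eq_esum => y _; rewrite funeposE; apply/max_idPl; exact: u0.
  by move=> y _; rewrite funenegE; apply/max_idPr; rewrite leeNl oppe0; exact: u0.
have t0 x : (0 <= (transfer T g \1_A x)%:E)%E.
  by rewrite lee_fin tE; apply: fine_ge0; apply: esum_ge0 => y _; exact: u0.
have mt : measurable_fun setT (EFin \o transfer T g \1_A) by case/integrableP: hi.
have /ae_eq_integral_abs : (\int[mu]_x `|(EFin \o transfer T g \1_A) x| = 0)%E.
  rewrite -[RHS]A0 -[in RHS](setIT A) -integral_indic// -[RHS]hint.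
  by apply: eq_integral => x _; rewrite /= ger0_norm// -lee_fin.
move=> /(_ measurableT mt) ht0.
apply: filterS2 hs ht0 => x sx /(_ I)/= [] tx y Ay Ty.
have le : ((g y * \1_A y)%:E <= \esum_(y in T @^-1` [set x]) (g y * \1_A y)%:E)%E.
  apply: esum_ge; exists [set y]; last by rewrite fsbig_set1.
  by split => // _ ->.
have fin : (\esum_(y in T @^-1` [set x]) (g y * \1_A y)%:E)%E \is a fin_num.
  rewrite ge0_fin_numE; last by apply: esum_ge0 => z _; exact: u0.
  apply: le_lt_trans sx; apply: le_esum => z _; exact: lee_abs.
move: le; rewrite -(fineK fin) -tE tx lee_fin indicE mem_set// mulr1 => gy.
by apply/eqP; rewrite eq_le gy g0.
Qed.

End Transfer.

Section OneSidedLimits.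
Context {d : Order.disp_t} {R : realType} {X : measurableOrderTopologicalType d}.

Lemma one_sided_proper (p : X * bool) : tail_mem setT p -> ProperFilter (one_sided p).
Proof.
case=> _ cl; apply: Build_ProperFilter_ex.
by move=> P /cl[z [[_ sz] Pz]]; exists z; exact: Pz.
Qed.

Lemma lim_one_sided_ge0 (aX bX : X) (mu : probability X R) (N : countType)
    (a b : N -> X) (T : X -> X) (g : X -> R) p :
  standing_assumptions aX bX mu a b T g -> endpoint_tail a b p ->
  0 <= lim (g @ one_sided p).
Proof.
move=> hM et; have := one_sided_proper et.1 => ?.
apply: limr_ge; first exact: (sa_g_limits hM et).
by apply: nearW => x; exact: (sa_g_ge0 hM).
Qed.

End OneSidedLimits.

(** * The estimate with real constants *)

Section MainEstimate.
Context {d : Order.disp_t} {R : realType} {X : measurableOrderTopologicalType d}.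
Context {aX bX : X} {mu : probability X R} {N : countType} {a b : N -> X}.
Context {T : X -> X} {g : X -> R} (hM : standing_assumptions aX bX mu a b T g).
Context {f f' : X -> R} (intf : mu.-integrable setT (EFin \o f)).
Context (ff' : {ae mu, forall x, f' x = f x}).
Context {M : nat} (M0 : (0 < M)%N) {c e : 'I_M -> X}.
Context (Jdisj : forall m k, m <> k ->
  (ccI (c m) (e m))° `&` (ccI (c k) (e k))° = set0).
Context (Jnull : forall m k, m <> k ->
  mu (ccI (c m) (e m) `&` ccI (c k) (e k)) = 0%E).
Context (JH : forall p, hanging a b aX bX T p ->
  exists m, tail_mem (ccI (c m) (e m)) p).
Context {W : X -> R} {V : R} (WV : forall x, 0 <= W x <= V).
Context (Wm : {homo W : x y / (x <= y)%O}) (domW : dominates setT W f').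
(** Real stand-ins: [G n] and [Vg n] for the essential bound and the variation of [g] on [I_n],
    [h m] for the hanging weight of [J_m], the others for the four extrema of the inequality. The
    bounds by [B1] and [B2] are multiplied out, so that [Vg n] and [h m] vanish on null
    intervals. *)
Context {G Vg : N -> R} {h : 'I_M -> R} {A1 A2 B1 B2 : R}.
Context (B10 : 0 <= B1) (B20 : 0 <= B2).
Context (G0 : forall n, 0 <= G n) (Vg0 : forall n, 0 <= Vg n) (h0 : forall m, 0 <= h m).
Context (gG : forall n, {ae mu, forall x, ooI (a n) (b n) x -> g x <= G n}).
Context (G_null : forall n, mu (ccI (a n) (b n)) = 0%E -> G n = 0).
Context (gVg : forall n, (pointwise_variation (ooI (a n) (b n)) g <= (Vg n)%:E)%E).
Context (hA1 : forall n, G n + Vg n <= A1).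
Context (hB1 : forall n, Vg n <= B1 * fine (mu (ccI (a n) (b n)))).
Context (hh : forall m (s : seq (X * bool)), uniq s ->
  (forall p, p \in s -> hanging a b aX bX T p /\ tail_mem (ccI (c m) (e m)) p) ->
  \sum_(p <- s) lim (g @ one_sided p) <= h m).
Context (hA2 : forall m, h m <= A2).
Context (hB2 : forall m, h m <= B2 * fine (mu (ccI (c m) (e m)))).

Let O n : set X := ooI (a n) (b n).
Let C m : set X := core c e m.
Let gl (p : X * bool) : R := lim (g @ one_sided p).
Let absint (A : set X) : R := fine (\int[mu]_(x in A) `|f x|%:E)%E.

Let mopen (U : set X) : open U -> measurable U.
Proof. by case: (sa_measure hM) => + _ _ _; exact. Qed.

Let mO n : measurable (O n).
Proof. exact: measurable_ooI. Qed.

Let mC m : measurable (C m).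
Proof. exact: measurable_core. Qed.

Let mf : measurable_fun setT f.
Proof. by apply/measurable_EFinP; case/integrableP: intf. Qed.

Let mabsf (A : set X) : measurable_fun A (fun x => `|f x|%:E).
Proof.
by apply: measurable_funTS; apply/measurable_EFinP; apply: measurableT_comp.
Qed.

Let absint_fin (A : set X) : measurable A ->
  (\int[mu]_(x in A) `|f x|%:E)%E \is a fin_num.
Proof.
move=> mA; rewrite ge0_fin_numE; last by apply: integral_ge0 => x _; rewrite lee_fin.
have := integrableS measurableT mA (@subsetT _ _) intf.
by case/integrableP.
Qed.

Let absint_ge0 (A : set X) : 0 <= absint A.
Proof. by apply: fine_ge0; apply: integral_ge0 => x _; rewrite lee_fin. Qed.

Let absint_null (A : set X) : measurable A -> mu A = 0%E -> absint A = 0.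
Proof.
move=> mA A0; have mfA : measurable_fun A (EFin \o f).
  by apply/measurable_EFinP; exact: measurable_funTS.
by have /(congr1 fine) := integral_abs_eq0 mA mfA A0.
Qed.

Let sum_absint (J : choiceType) (s : seq J) (A : J -> set X) : uniq s ->
  trivIset [set` s] A -> (forall j, measurable (A j)) ->
  \sum_(j <- s) absint (A j) <= absint setT.
Proof.
move=> us tA mA; rewrite -lee_fin -sumEFin /absint fineK ?absint_fin//.
under eq_bigr do rewrite fineK ?absint_fin//.
by apply: sum_integral_le => // x; rewrite lee_fin.
Qed.

Let Obranch n : branch T (a n) (b n).
Proof. exact: (sa_branch hM n). Qed.

Let Odisj n m : n <> m -> O n `&` O m = set0.
Proof. by move=> nm; exact: (sa_disjoint hM nm). Qed.

Let unionO : mu.-negligible (~` \bigcup_n O n).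
Proof.
have mU : measurable (\bigcup_n O n).
  by apply: mopen; apply: bigcup_open => n _; exact: itv_open.
apply/negligibleP; first exact: measurableC.
by have := probability_setC mu mU; rewrite (sa_full hM) subee.
Qed.

Let endpoint_notin n m : ~ O m (a n) /\ ~ O m (b n).
Proof.
have [->|/eqP nm] := eqVneq n m.
  by split => /ooIP[]; rewrite ltxx.
exact: (branch_disjoint (Obranch n) (Odisj nm)).
Qed.

Let O_separated n m : n <> m -> (a n <= a m)%O ->
  forall x x', O n x -> O m x' -> (x < x')%O.
Proof.
move=> nm anm x x' /ooIP[_ xb] /ooIP[ax' _].
suff ba : (b n <= a m)%O by exact: (lt_trans (lt_le_trans xb ba)).
rewrite leNgt; apply/negP => amb; have [+ _] := endpoint_notin m n.
apply; apply/ooIP; split => //; rewrite lt_neqAle anm andbT; apply/eqP.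
by have [] := branch_endpoint_inj (Obranch n) (Obranch m) (Odisj nm).
Qed.

(** The endpoints lie in no [O m], hence in the null complement of their union. *)
Let measureO n : mu (O n) = mu (ccI (a n) (b n)).
Proof.
apply/eqP; rewrite eq_le; apply/andP; split.
  apply: le_measure; rewrite ?inE; [exact: mO|exact: measurable_ccI|exact: ooI_ccI].
rewrite (measureDI _ (measurable_ccI mopen _ _) (mO n)) [X in (X + _)%E](_ : _ = 0%E).
  rewrite add0e; apply: le_measure; rewrite ?inE; last by [].
    by apply: measurableI => //; exact: measurable_ccI.
  exact: mO.
apply: measure_negligible; first by apply: measurableD => //; exact: measurable_ccI.
apply: negligibleS unionO => x [/ccI_split[->|->|//] _] [m _].
  by have [] := endpoint_notin n m.
by have [] := endpoint_notin n m.
Qed.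

Let oscW (A : set X) x y : A x -> A y -> `|f' x| <= `|f' y| + oscillation W A.
Proof.
move=> Ax Ay; suff : `|f' x - f' y| <= oscillation W A.
  by have := ler_normD (f' y) (f' x - f' y); rewrite addrC subrK; lra.
have [xy|/ltW yx] := leP x y.
  rewrite distrC; apply: le_trans (domW I I xy) _; exact: (oscillation_ge WV Ax Ay).
by apply: le_trans (domW I I yx) _; exact: (oscillation_ge WV Ay Ax).
Qed.

Let mean_value (A : set X) x : measurable A -> A x -> mu A != 0%E ->
  `|f' x| <= oscillation W A + absint A / fine (mu A).
Proof.
move=> mA Ax A0; have fA : mu A \is a fin_num by exact: fin_num_measure.
have pA : 0 < fine (mu A) by rewrite fine_gt0// lt0e A0 measure_ge0/= -ge0_fin_numE.
have := le_mean_value mA mf ff' (oscillation_ge0 A WV) (normr_ge0 (f' x))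
  (fun z Az => oscW Ax Az).
have -> : (\int[mu]_(x in A) `|f x|%:E = (absint A)%:E)%E by rewrite fineK// absint_fin.
have -> : measure_function.Measure.sort mu A = (fine (mu A))%:E by rewrite fineK.
rewrite -!EFinM -EFinD lee_fin => le.
by rewrite -(ler_pM2r pA) mulrDl divfK ?gt_eqF// addrC.
Qed.

(** One interval is chosen per hanging point, so that each jump is charged once; [0 < M] provides
    the default elsewhere. *)
Let tail_index : exists mm : X * bool -> 'I_M, forall p, hanging a b aX bX T p ->
  tail_mem (ccI (c (mm p)) (e (mm p))) p.
Proof.
have /choice[mm hmm] : forall p, exists m : 'I_M, hanging a b aX bX T p ->
    tail_mem (ccI (c m) (e m)) p.
  move=> p; have [Hp|nHp] := pselect (hanging a b aX bX T p).
    by have [m] := JH Hp; exists m.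
  by exists (Ordinal M0).
by exists mm.
Qed.

Let gl_cvg p : hanging a b aX bX T p -> g @ one_sided p --> gl p.
Proof. by move=> [et _]; exact: (sa_g_limits hM et). Qed.

Let gl_ge0 p : hanging a b aX bX T p -> 0 <= gl p.
Proof. by move=> Hp; exact: (lim_one_sided_ge0 hM Hp.1). Qed.

(* Bounds [|f'|] on the core of [J_m]. If [J_m] is a null set then the quotient is
   [0] and the bound fails, but [hB2] makes [g(p) = 0] for the hanging points [p] of
   [J_m]. *)
Let K m := oscillation W (C m) + absint (C m) / fine (mu (ccI (c m) (e m))).

Let K_ge0 m : 0 <= K m.
Proof.
by rewrite addr_ge0 ?(oscillation_ge0 _ WV)// divr_ge0 ?absint_ge0 ?fine_ge0.
Qed.

Let muC m : mu (C m) = mu (ccI (c m) (e m)).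
Proof. exact: measure_core. Qed.

Let gl_bound p m z : hanging a b aX bX T p -> tail_mem (ccI (c m) (e m)) p ->
  C m z -> gl p * `|f' z| <= gl p * K m.
Proof.
move=> Hp tp Cz; have [J0|J0] := eqVneq (mu (ccI (c m) (e m))) 0%E.
  have : gl p <= 0.
    have := @hh m [:: p] isT; rewrite big_seq1 => /(_ _)/le_trans.
    apply; last by have := hB2 m; rewrite J0/= mulr0.
    by move=> q; rewrite inE => /eqP->.
  move=> gle; have -> : gl p = 0 by apply/eqP; rewrite eq_le gle gl_ge0.
  by rewrite !mul0r.
apply: ler_wpM2l; first exact: gl_ge0.
by have := mean_value (mC m) Cz; rewrite muC; apply.
Qed.

Let f'_bounded : exists2 B : R, 0 < B & forall x, `|f' x| <= B.
Proof.
exists (`|f' point| + oscillation W setT + 1) => [|x].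
  by rewrite ltr_wpDl// addr_ge0// (oscillation_ge0 _ WV).
have := @oscW setT x point I I; lra.
Qed.

(** [z] is taken in the core of [J_m], where [K m] controls [|f'|], and so close to [p] that [g z]
    exceeds its limit by at most [eps / B], with [B] a global bound for [|f'|]. *)
Let approach p m (eps : R) (U : set X) : hanging a b aX bX T p ->
  tail_mem (ccI (c m) (e m)) p -> 0 < eps -> nbhs p.1 U ->
  exists z, [/\ U z, side p z & g z * `|f' z| <= gl p * K m + eps].
Proof.
move=> Hp tp eps0 nU; have [B B0 fB] := f'_bounded.
have d0 : 0 < eps / B by rewrite divr_gt0.
have : \forall z \near one_sided p, g z <= gl p + eps / B.
  have /cvgrPdist_le/(_ _ d0) := gl_cvg Hp.
  by apply: filterS => z; rewrite ler_norml; lra.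
rewrite /one_sided /prop_near1 /within/= => nG.
have [z [[Uz Gz] sz Cz]] := core_tail Jdisj tp (filterI nU nG).
exists z; split => //.
have := gl_bound Hp tp Cz; have {Gz} := Gz sz => Gz.
have := ler_wpM2r (normr_ge0 (f' z)) Gz.
have : eps / B * `|f' z| <= eps.
  by rewrite -{2}(divfK (lt0r_neq0 B0) eps) ler_wpM2l// ltW.
by rewrite mulrDl; lra.
Qed.

Let mm : X * bool -> 'I_M := sval (cid tail_index).
Let mmP p : hanging a b aX bX T p -> tail_mem (ccI (c (mm p)) (e (mm p))) p.
Proof. exact: (svalP (cid tail_index)). Qed.

(** [0] is legitimate at a tail that is not hanging: no point of [D] below is then sent to that
    endpoint by the section. *)
Let jump (p : X * bool) : R := if `[< hanging a b aX bX T p >] then gl p * K (mm p) else 0.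

Let jump_ge0 p : 0 <= jump p.
Proof.
rewrite /jump; case: asboolP => // Hp.
by apply: mulr_ge0; [exact: gl_ge0|exact: K_ge0].
Qed.

Let bad : set X := [set y | f' y <> f y] `|` \bigcup_n (O n `&` [set y | ~ (g y <= G n)]).

Let bad_null : measurable bad /\ mu bad = 0%E.
Proof.
have nb : mu.-negligible bad.
  apply: negligibleU; first exact: ff'.
  apply: countable_negligible_bigcup => n; apply: negligibleS; last exact: (gG n).
  by move=> y [Oy gy] /= /(_ Oy).
have [_ cm _ _] := sa_measure hM.
by split; [exact: cm|apply: measure_negligible => //; exact: cm].
Qed.

(** On the fibres of these points [g] vanishes wherever the representative or the essential bound
    fails. [aX] and [bX] are left out because a section may take an endpoint as value there without
    a hanging point; they are null, being in no [O n]. *)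
Let D : set X := [set x | [/\ x <> aX, x <> bX,
  summable (T @^-1` [set x]) (fun y => (g y * f y)%:E) &
  forall y, bad y -> T y = x -> g y = 0]].

Let D_conull : mu.-negligible (~` D).
Proof.
have [mb b0] := bad_null.
have e1 : {ae mu, forall x, (\bigcup_n O n) x} by exact: unionO.
have [e2 _ _] := sa_preserves hM intf.
have e3 := transfer_null (sa_preserves hM) (sa_g_ge0 hM) mb b0.
apply: negligibleS; last exact: (filterI (filterI e1 e2) e3).
move=> x /= Dx [[Ux sx] bx].
apply: Dx; case: Ux => n _ /ooIP[ax xb]; split => // xe.
  by have /andP[] := sa_bounds hM (a n); rewrite leNgt -xe ax.
by have /andP[_] := sa_bounds hM (b n); rewrite leNgt -xe xb.
Qed.

Let D_nonempty : D !=set0.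
Proof.
apply/set0P/negP => /eqP D0; have := D_conull; rewrite D0 setC0 => /measure_negligible.
move=> /(_ measurableT) T0.
by have /eqP := etrans (esym (probability_setT mu)) T0; rewrite onee_eq0.
Qed.

Let good x y : D x -> T y = x -> g y * f y = g y * f' y /\ forall n, O n y -> g y <= G n.
Proof.
move=> [_ _ _ bx] Ty; have [/bx -/(_ Ty) gy|nb] := pselect (bad y).
  by rewrite gy !mul0r; split => // n _; exact: G0.
split; first by congr (_ * _); apply: contrapT => ne; apply: nb; left => /esym.
by move=> n On; apply: contrapT => ng; apply: nb; right; exists n.
Qed.

Let is_section n (y : X -> X) := [/\ forall x, ccI (a n) (b n) (y x),
  {homo y : x x' / (x <= x')%O} \/ {homo y : x x' / (x <= x')%O >-> (x' <= x)%O},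
  forall x, O n (y x) -> T (y x) = x,
  forall z, O n z -> y (T z) = z
  & forall x, x <> aX -> x <> bX ->
    (y x = a n -> hanging a b aX bX T (a n, true)) /\
    (y x = b n -> hanging a b aX bX T (b n, false))].

Let section n : exists y, is_section n y.
Proof.
have [y [cy ym Ty yT hy]] := branch_inverse (sa_bounds hM) (Obranch n).
have [ab ta tb] := branch_tail (Obranch n).
exists y; split => // x xa xb; have [h1 h2] := hy x xa xb; split => [/h1|/h2] hl.
  split => //; split; first exact: tail_memS ta.
  by exists n; left.
split => //; split; first exact: tail_memS tb.
by exists n; right.
Qed.

Let y n := sval (cid (section n)).
Let yP n : is_section n (y n). Proof. exact: (svalP (cid (section n))). Qed.

Let phi n x : R := g (y n x) * f' (y n x).

(** All weights involved vanish where [g] does, in particular at the endpoints of the [I_n], so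
    fibre sums become sums over branches. *)
Let fibre_sum x : D x ->
  summable setT (EFin \o phi^~ x) /\
  transfer T g f x =
    fine (\esum_(n in setT) (EFin \o phi^~ x)^\+ n
          - \esum_(n in setT) (EFin \o phi^~ x)^\- n)%E.
Proof.
move=> Dx.
have sec (w : X -> \bar R) : (forall z, g z = 0 -> w z = 0%E) ->
    (\esum_(z in T @^-1` [set x]) w z = \esum_(n in setT) w (y n x))%E.
  move=> w0; have gend n : g (a n) = 0 /\ g (b n) = 0 by exact: (sa_g_endpoints hM).
  apply: (@esum_sections _ _ _ _ O) => //.
  - by move=> n; have [_ _ + _ _] := yP n; exact.
  - by move=> n z Oz /= <-; have [_ _ _ + _] := yP n; apply.
  - move=> z _ nO; apply: w0.
    have [n _ /ccI_split[->|->|Oz]] : (\bigcup_n ccI (a n) (b n)) z by rewrite (sa_cover hM).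
    + by case: (gend n).
    + by case: (gend n).
    + by have := nO n.
  - move=> n nO; apply: w0; have [cy _ _ _ _] := yP n.
    by have [->|->|//] := ccI_split (cy x); case: (gend n).
have eq_fibre z : T z = x -> g z * f z = g z * f' z by move=> Tz; have [] := good Dx Tz.
split.
  have [_ _ sx _] := Dx; move: sx; rewrite /summable.
  rewrite (eq_esum (b := fun z => `|(g z * f' z)%:E|%E)); last first.
    by move=> z Tz; rewrite eq_fibre.
  by rewrite sec // => z ->; rewrite mul0r abse0.
rewrite /transfer; congr (fine (_ - _)%E).
  rewrite (eq_esum (b := fun z => (Order.max (g z * f' z)%:E 0)%E)); last first.
    by move=> z Tz; rewrite funeposE/= eq_fibre.
  rewrite sec; last by move=> z ->; rewrite mul0r maxxx.
  by apply: eq_esum => n _; rewrite funeposE.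
rewrite (eq_esum (b := fun z => (Order.max (- (g z * f' z)%:E) 0)%E)); last first.
  by move=> z Tz; rewrite funenegE/= eq_fibre.
rewrite sec; last by move=> z ->; rewrite mul0r oppe0 maxxx.
by apply: eq_esum => n _; rewrite funenegE.
Qed.

Let total n := A1 * oscillation W (O n) + B1 * absint (O n)
  + jump (a n, true) + jump (b n, false).

Let jump_eq p : hanging a b aX bX T p -> jump p = gl p * K (mm p).
Proof. by move=> Hp; rewrite /jump asboolT. Qed.

Let phi_dominated n : exists Z, dominates D Z (phi n) /\
  forall x x', D x -> D x' -> Z x' - Z x <= total n.
Proof.
have [ab _ _] := branch_tail (Obranch n).
have [ga gb] := sa_g_endpoints hM n.
have [cy ym Ty yT hy] := yP n.
have gG' x : D x -> O n (y n x) -> g (y n x) <= G n.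
  by move=> Dx Oy; apply: (good Dx (Ty _ Oy)).2.
have osc0 : 0 <= oscillation W (O n) by exact: (oscillation_ge0 _ WV).
have A1osc := ler_wpM2r osc0 (hA1 n).
(* No mean is available on a null interval, but there [G n = 0] makes [phi n] vanish on [D]. *)
have [I0|I0] := eqVneq (mu (ccI (a n) (b n))) 0%E.
  have phi0 x : D x -> phi n x = 0.
    move=> Dx; rewrite /phi; have [->|->|Oy] := ccI_split (cy x); rewrite ?ga ?gb ?mul0r//.
    have g0 : g (y n x) = 0.
      by apply/eqP; rewrite eq_le (sa_g_ge0 hM) andbT -(G_null I0) gG'.
    by rewrite g0 mul0r.
  exists (fun=> 0); split => [x x' Dx Dx' _|x x' _ _].
    by rewrite !phi0// subrr normr0.
  have i0 : absint (O n) = 0.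
    by apply: absint_null => //; rewrite measureO.
  have GV : 0 <= (G n + Vg n) * oscillation W (O n) by rewrite mulr_ge0// addr_ge0.
  rewrite /total i0; have := jump_ge0 (a n, true); have := jump_ge0 (b n, false); lra.
have fI : 0 < fine (mu (ccI (a n) (b n))).
  rewrite fine_gt0// lt0e I0 measure_ge0/= -ge0_fin_numE// fin_num_measure//.
  exact: measurable_ccI.
pose Kn := oscillation W (O n) + absint (O n) / fine (mu (ccI (a n) (b n))).
have Kn0 : 0 <= Kn by rewrite addr_ge0// divr_ge0// ltW.
have fK z : O n z -> `|f' z| <= Kn.
  by move=> Oz; have := mean_value (mO n) Oz; rewrite measureO; apply.
have ne : O n !=set0.
  by have [z _ Oz] := branch_ooI_nbhs (U := setT) (Obranch n) (or_introl (filterT)); exists z.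
have [x Dx|x Dx|Z [dZ tZ]] := branch_dominated ab ne WV domW (G0 n) Kn0 (Vg0 n)
  (jump_ge0 (a n, true)) (jump_ge0 (b n, false)) (gVg n) (sa_g_ge0 hM) ga gb fK ym cy gG'.
- move=> ye t eps Ot eps0.
  have Hp : hanging a b aX bX T (a n, true).
    by have [xa xb _ _] := Dx; have [+ _] := hy x xa xb; apply.
  have /ooIP[at_ tb] := Ot.
  have [z [/= zt az gz]] := approach Hp (mmP Hp) eps0 (nbhs_lray at_).
  exists z; split; [apply/ooIP; split => //; exact: lt_trans tb|exact: ltW|].
  by rewrite jump_eq.
- move=> ye t eps Ot eps0.
  have Hp : hanging a b aX bX T (b n, false).
    by have [xa xb _ _] := Dx; have [_ +] := hy x xa xb; apply.
  have /ooIP[at_ tb] := Ot.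
  have [z [/= tz zb gz]] := approach Hp (mmP Hp) eps0 (nbhs_rray tb).
  exists z; split; [apply/ooIP; split => //; exact: lt_trans tz|exact: ltW|].
  by rewrite jump_eq.
exists Z; split => // x x' Dx Dx'; apply: le_trans (tZ _ _ Dx Dx') _.
rewrite /total.
(* The oscillation term joins [G n * oscillation W (O n)] under [A1]; the mean term is absorbed by
   [Vg n <= B1 * mu (I_n)]. *)
suff : Kn * Vg n <= Vg n * oscillation W (O n) + B1 * absint (O n).
  by move: A1osc; rewrite mulrDl; lra.
rewrite mulrDl mulrC lerD2l -mulrA mulrC; apply: ler_wpM2r => //.
by rewrite ler_pdivrMl// mulrC.
Qed.

(** The jumps are regrouped by the [J_m] chosen for them. Each group is at most [h m * K m], whose
    two terms are summed over the disjoint cores. *)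
Let sum_jumps (s : seq N) : uniq s ->
  \sum_(n <- s) (jump (a n, true) + jump (b n, false)) <=
  A2 * V + B2 * absint setT.
Proof.
move=> us.
(* No tail is listed twice, as distinct branches have distinct left endpoints and distinct right
   endpoints. *)
pose P := [seq (a n, true) | n <- s] ++ [seq (b n, false) | n <- s].
have uP : uniq P.
  rewrite cat_uniq; apply/and3P; split.
  - rewrite map_inj_uniq// => n m [nm]; apply: contrapT => ne.
    by have [+ _] := branch_endpoint_inj (Obranch n) (Obranch m) (Odisj ne); apply.
  - by apply/hasPn => _ /mapP[n _ ->]; apply/mapP => -[].
  - rewrite map_inj_uniq// => n m [nm]; apply: contrapT => ne.
    by have [_ +] := branch_endpoint_inj (Obranch n) (Obranch m) (Odisj ne); apply.
have -> : \sum_(n <- s) (jump (a n, true) + jump (b n, false)) = \sum_(p <- P) jump p.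
  by rewrite big_split big_cat !big_map.
rewrite (bigID (fun p => `[< hanging a b aX bX T p >]))/= [X in _ + X]big1 ?addr0; last first.
  by move=> p /asboolP np; rewrite /jump; case: asboolP.
rewrite -big_filter; set Q := [seq p <- P | _].
have HQ p : p \in Q -> hanging a b aX bX T p.
  by rewrite mem_filter => /andP[/asboolP].
rewrite (partition_big mm xpredT)//=.
apply: (@le_trans _ _ (\sum_(m < M) (A2 * oscillation W (C m) + B2 * absint (C m)))).
  apply: ler_sum => m _.
  have -> : \sum_(p <- Q | mm p == m) jump p =
      (\sum_(p <- [seq p <- Q | mm p == m]) gl p) * K m.
    rewrite mulr_suml big_filter big_seq_cond [RHS]big_seq_cond.
    by apply: eq_bigr => p /andP[/HQ Hp /eqP <-]; rewrite jump_eq.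
  have le : \sum_(p <- [seq p <- Q | mm p == m]) gl p <= h m.
    apply: hh; first by rewrite !filter_uniq.
    move=> p; rewrite mem_filter => /andP[/eqP <- /HQ Hp].
    by split => //; exact: mmP.
  apply: (@le_trans _ _ (h m * K m)); first by apply: ler_wpM2r.
  rewrite /K mulrDr; apply: lerD.
    by apply: ler_wpM2r => //; exact: (oscillation_ge0 _ WV).
  rewrite mulrCA mulrC; apply: ler_wpM2r => //.
  (* Real inversion sends [0] to [0], so the quotient vanishes on a null [J_m]. *)
  have [J0|J0] := eqVneq (mu (ccI (c m) (e m))) 0%E.
    by rewrite J0/= invr0 mulr0.
  have fJ : 0 < fine (mu (ccI (c m) (e m))).
    rewrite fine_gt0// lt0e J0 measure_ge0/= -ge0_fin_numE// fin_num_measure//.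
    exact: measurable_ccI.
  by rewrite ler_pdivrMr.
rewrite big_split/= -!mulr_sumr; apply: lerD.
  apply: ler_wpM2l; last first.
    apply: sum_oscillation_le => //; first exact: index_enum_uniq.
    move=> m k _ _ mk; have [cmk|/ltW ckm] := leP (c m) (c k).
      by left=> x x' Cx Cx'; exact: (core_separated mk Cx Cx' cmk).
    rewrite eq_sym in mk.
    by right=> x x' Cx Cx'; exact: (core_separated mk Cx' Cx ckm).
  exact: (le_trans (h0 _) (hA2 (Ordinal M0))).
apply: ler_wpM2l => //; apply: sum_absint => //; first exact: index_enum_uniq.
by apply/trivIsetP => m k _ _ mk; exact: core_disjoint.
Qed.

Let sum_total (s : seq N) : uniq s ->
  \sum_(n <- s) total n <= (A1 + A2) * V + (B1 + B2) * absint setT.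
Proof.
move=> us; have [n0 _ _] : (\bigcup_n ccI (a n) (b n)) aX by rewrite (sa_cover hM).
have A10 : 0 <= A1 by rewrite (le_trans _ (hA1 n0))// addr_ge0.
have osc : \sum_(n <- s) oscillation W (O n) <= V.
  apply: sum_oscillation_le => // n m _ _ /eqP nm.
  have [nm'|/ltW mn'] := leP (a n) (a m).
    by left=> x x'; exact: (O_separated nm nm').
  by right=> x x' On Om; apply: (O_separated _ mn' Om On); exact/nesym.
have int : \sum_(n <- s) absint (O n) <= absint setT.
  by apply: sum_absint => //; apply/trivIsetP => n m _ _ /eqP/Odisj.
under eq_bigr do rewrite /total -addrA.
rewrite big_split/= big_split/= -!mulr_sumr.
have := sum_jumps us; have := ler_wpM2l A10 osc; have := ler_wpM2l B10 int.
by rewrite !mulrDl; lra.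
Qed.

(** A chain has finitely many points, so one finite list of branches approximates the fibre sums at
    all of them, and along the chain branch [n] contributes at most [total n]. *)
Lemma transfer_variation : (class_variation mu setT (transfer T g f) <=
  ((A1 + A2) * V + (B1 + B2) * fine (\int[mu]_x `|f x|%:E)%E)%:E)%E.
Proof.
rewrite -/(absint setT).
apply: (class_variation_conull D_nonempty D_conull (F := transfer T g f)) => //.
apply: pointwise_variation_le => m x Dx xlt; apply/ler_addgt0Pr => eps eps0.
(* Each of the [m] increments carries two approximation errors; [m.+1] keeps the divisor nonzero for
   a one-point chain. *)
have d0 : 0 < eps / (2 * m.+1%:R) by rewrite divr_gt0// mulr_gt0.
set dl := eps / (2 * m.+1%:R) in d0.
have /choice[sf hsf] : forall i, exists s : seq N, (i <= m)%N ->
    forall s', uniq s' -> {subset s <= s'} ->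
    `|transfer T g f (x i) - \sum_(n <- s') phi n (x i)| <= dl.
  move=> i; have [im|_] := leqP i m; last by exists [::].
  have [sx ->] := fibre_sum (Dx _ im).
  by have [s hs] := summable_approx sx d0; exists s.
pose S := undup (flatten [seq sf i | i <- iota 0 m.+1]).
have FS i : (i <= m)%N -> `|transfer T g f (x i) - \sum_(n <- S) phi n (x i)| <= dl.
  move=> im; apply: hsf => //; first exact: undup_uniq.
  move=> n si; rewrite mem_undup; apply/flatten_mapP; exists i => //.
  by rewrite mem_iota add0n.
have /choice[Z hZ] := phi_dominated.
apply: (@le_trans _ _ (\sum_(i < m) (dl * 2 +
    \sum_(n <- S) `|phi n (x i.+1) - phi n (x i)|))).
  apply: ler_sum => i _.
  have := FS _ (ltn_ord i); have := FS _ (ltnW (ltn_ord i)).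
  have := ler_norm_sum S (fun n => phi n (x i.+1) - phi n (x i)) xpredT.
  rewrite sumrB; set q := \sum_(n <- S) phi n (x i); set p := \sum_(n <- S) phi n _.
  set t' := transfer T g f (x i); set t := transfer T g f _.
  have := ler_normD (t - p) (p - q + (q - t')).
  have -> : t - p + (p - q + (q - t')) = t - t' by ring.
  have := ler_normD (p - q) (q - t'); rewrite (distrC q t'); lra.
rewrite big_split/= addrC sumr_const card_ord exchange_big/=; apply: lerD.
  apply: le_trans (sum_total (undup_uniq _)); apply: ler_sum => n _.
  have [dZ tZ] := hZ n.
  apply: le_trans (tZ _ _ (Dx 0 _) (Dx m _)) => //.
  exact: (chain_dominated dZ Dx xlt).
have <- : dl * (2 * m.+1%:R) = eps.
  by rewrite divfK// mulf_neq0// pnatr_eq0.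
rewrite -(mulr_natr (dl * 2)) -mulrA; apply: ler_wpM2l; first exact: ltW.
by apply: ler_wpM2l => //; rewrite ler_nat.
Qed.

End MainEstimate.

(** * Quotients, essential bounds and variations in the extended reals *)

Section ExtendedReals.
Context {R : realType}.
Local Open Scope ereal_scope.

(** For [y = 0] the inverse is [+oo], so a finite bound on the quotient forces [x = 0]. *)
Lemma le_of_dive_le (x y : \bar R) (k : R) : 0 <= x -> 0 <= y -> y <= 1 ->
  x / y <= k%:E -> x <= (k * fine y)%:E.
Proof.
move=> x0 y0 y1; have yf : y \is a fin_num.
  by rewrite ge0_fin_numE//; exact: (le_lt_trans y1 (ltry 1)).
move: y0 y1; rewrite -(fineK yf) /= => y0 _; rewrite inver; case: eqVneq => [->|yn].
  rewrite mulr0; move: x0; rewrite le_eqVlt => /predU1P[<-//|x0].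
  by rewrite gt0_muley// leye_eq.
by rewrite lee_pdivrMr ?EFinM// lt_neqAle eq_sym yn -lee_fin.
Qed.

End ExtendedReals.

Section EssentialBound.
Context {dd : measure_display} {Y : measurableType dd} {R : realType}.
Context (mu : probability Y R) (A : set Y) (g : Y -> R) (B : R).
Context (g0 : forall x, 0 <= g x) (gB : forall x, g x <= B).
Local Notation G := ('N[mu]_+oo[(EFin \o g) \_ A])%E.

Let muT : (0 < mu setT)%E.
Proof. by have := probability_setT mu => /= ->; rewrite lte01. Qed.

Let GE : G = ess_sup mu (abse \o ((EFin \o g) \_ A)).
Proof. by rewrite unlock /Lnorm muT. Qed.

Lemma essential_bound_le : (G <= B%:E)%E.
Proof.
rewrite GE; apply/ess_supP; apply: nearW => x /=.
rewrite patchE; case: ifP => _ /=; first by rewrite lee_fin ger0_norm.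
by rewrite normr0 lee_fin (le_trans (g0 x)).
Qed.

Lemma essential_bound_fin : G \is a fin_num.
Proof.
rewrite ge0_fin_numE; last exact: Lnorm_ge0.
exact: (le_lt_trans essential_bound_le (ltry B)).
Qed.

Lemma essential_boundP : {ae mu, forall x, A x -> g x <= fine G}.
Proof.
have := ess_sup_ge mu (abse \o ((EFin \o g) \_ A)); rewrite -GE.
apply: filterS => x /= + Ax; rewrite patchE mem_set//= ger0_norm//.
by rewrite -(fineK essential_bound_fin) lee_fin.
Qed.

Lemma essential_bound_null : measurable A -> mu A = 0%E -> G = 0%E.
Proof.
move=> mA A0; rewrite GE; apply: abs_ess_sup_eq0 => //.
have nA : mu.-negligible A by exact/negligibleP.
apply: negligibleS nA => x; apply: contra_notP => nAx _ /=.
by rewrite patchE memNset.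
Qed.

End EssentialBound.

Section VariationValues.
Context {d : Order.disp_t} {R : realType} {X : measurableOrderTopologicalType d}.
Implicit Types (C : set X) (f : X -> R).

Lemma pointwise_variation_ge0 C f : C !=set0 -> (0 <= pointwise_variation C f)%E.
Proof.
move=> [x Cx]; apply: ereal_sup_ubound.
by exists 0, (fun=> x); split => //; rewrite big_ord0.
Qed.

Lemma class_variation_ge0 (mu : set X -> \bar R) f : (0 <= class_variation mu setT f)%E.
Proof.
by apply: le_ereal_inf_tmp => _ [f' _ <-]; apply: pointwise_variation_ge0; exists point.
Qed.

End VariationValues.

(** * Passage from the real constants to the extended real inequality *)

Theorem proposition3p6 (d : Order.disp_t) (R : realType)
    (X : measurableOrderTopologicalType d) (aX bX : X)
    (mu : probability X R) (N : countType) (a b : N -> X)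
    (T : X -> X) (g : X -> R)
    (hM : standing_assumptions aX bX mu a b T g)
    (hvar : (ereal_sup (range (fun n =>
       pointwise_variation (ooI (a n) (b n)) g / mu (ccI (a n) (b n)))) < +oo)%E)
    (hsum : (\esum_(p in hanging a b aX bX T)
       (lim (g @ one_sided p))%:E < +oo)%E)
    (f : X -> R) (hf : bounded_var mu f)
    (M : nat) (hM0 : (0 < M)%N) (c e : 'I_M -> X)
    (hJint : forall m, (ccI (c m) (e m))° !=set0)
    (hJdisj : forall m k, m <> k ->
       (ccI (c m) (e m))° `&` (ccI (c k) (e k))° = set0)
    (hJnull : forall m k, m <> k ->
       mu (ccI (c m) (e m) `&` ccI (c k) (e k)) = 0%E)
    (hJH : forall p, hanging a b aX bX T p ->
       exists m, tail_mem (ccI (c m) (e m)) p) :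
  let h m := hanging_weight aX bX a b T g (ccI (c m) (e m)) in
  (class_variation mu [set: X] (transfer T g f) <=
     (ereal_sup (range (fun n =>
          'N[mu]_+oo[(EFin \o g) \_ (ooI (a n) (b n))]
          + pointwise_variation (ooI (a n) (b n)) g))
      + \big[maxe/-oo]_(m < M) h m)
     * class_variation mu [set: X] f
   + (ereal_sup (range (fun n =>
          pointwise_variation (ooI (a n) (b n)) g / mu (ccI (a n) (b n))))
      + \big[maxe/-oo]_(m < M) (h m / mu (ccI (c m) (e m))))
     * 'N[mu]_1[EFin \o f])%E.
Proof.
cbv zeta; set h := (fun m : 'I_M => hanging_weight aX bX a b T g (ccI (c m) (e m))).
set S1 := ereal_sup (range (fun n =>
  'N[mu]_+oo[(EFin \o g) \_ (ooI (a n) (b n))] + pointwise_variation (ooI (a n) (b n)) g))%E.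
set S2 := ereal_sup (range (fun n =>
  pointwise_variation (ooI (a n) (b n)) g / mu (ccI (a n) (b n))))%E.
set H1 := \big[maxe/-oo%E]_(m < M) h m.
set H2 := \big[maxe/-oo%E]_(m < M) (h m / mu (ccI (c m) (e m)))%E.
have [mopen _ _ _] := sa_measure hM.
have [lf vf] := hf.
have intf : mu.-integrable setT (EFin \o f).
  apply/Lfun1_integrable; apply: (Lfun_subset (q := +oo%E)) lf => //; rewrite ?leey//.
  exact: fin_num_measure.
have mf : measurable_fun setT f by apply/measurable_EFinP; case/integrableP: intf.
have [n0 _ _] : (\bigcup_n ccI (a n) (b n)) aX by rewrite (sa_cover hM).
have ne n : ooI (a n) (b n) !=set0.
  have [z _ oz] := branch_ooI_nbhs (U := setT) (sa_branch hM n) (or_introl filterT).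
  by exists z.
pose Vg n := pointwise_variation (ooI (a n) (b n)) g.
pose G n := 'N[mu]_+oo[(EFin \o g) \_ (ooI (a n) (b n))]%E.
have Vg0 n : (0 <= Vg n)%E by exact: pointwise_variation_ge0.
have G0 n : (0 <= G n)%E by exact: Lnorm_ge0.
have [B gB] := sa_g_bounded hM.
have mI n : measurable (ccI (a n) (b n)) by exact: measurable_ccI.
have mJ m : measurable (ccI (c m) (e m)) by exact: measurable_ccI.
have S2_ge n : (Vg n / mu (ccI (a n) (b n)) <= S2)%E.
  by apply: ereal_sup_ubound; exists n.
have S20 : (0 <= S2)%E.
  by apply: le_trans (S2_ge n0); rewrite mule_ge0// inve_ge0.
have S2f : S2 \is a fin_num by rewrite ge0_fin_numE.
have VgS n : (Vg n <= (fine S2 * fine (mu (ccI (a n) (b n))))%:E)%E.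
  by apply: le_of_dive_le => //; [exact: probability_le1|rewrite fineK].
have Vgf n : Vg n \is a fin_num.
  by rewrite ge0_fin_numE//; exact: (le_lt_trans (VgS n) (ltry _)).
have Gf n : G n \is a fin_num by exact: (essential_bound_fin _ _ (sa_g_ge0 hM) gB).
have S1_ge n : (G n + Vg n <= S1)%E by apply: ereal_sup_ubound; exists n.
have S10 : (0 <= S1)%E by apply: le_trans (S1_ge n0); exact: adde_ge0.
have mu1 (A : set X) : measurable A -> fine (mu A) <= 1.
  by move=> mA; rewrite -lee_fin fineK ?fin_num_measure ?probability_le1.
(* [g] is bounded by [B], and [Vg n <= S2] since intervals have measure at most [1]. *)
have S1f : S1 \is a fin_num.
  rewrite ge0_fin_numE//; apply: (@le_lt_trans _ _ (B + fine S2)%:E); last exact: ltry.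
  apply: ge_ereal_sup => _ [n _ <-]; rewrite EFinD; apply: leeD.
    exact: (essential_bound_le _ _ (sa_g_ge0 hM) gB).
  apply: le_trans (VgS n) _; rewrite lee_fin ler_piMr// ?fine_ge0//; exact: mu1.
have hH p : hanging a b aX bX T p -> 0 <= lim (g @ one_sided p).
  by move=> Hp; exact: (lim_one_sided_ge0 hM Hp.1).
have h0 m : (0 <= h m)%E by apply: esum_ge0 => p [Hp _]; rewrite lee_fin hH.
have hfin m : h m \is a fin_num.
  rewrite ge0_fin_numE//; apply: le_lt_trans hsum.
  rewrite /h /hanging_weight esum_mkcondr; apply: le_esum => p Hp.
  by case: ifP => // _; rewrite lee_fin hH.
have H10 : (0 <= H1)%E.
  by apply: le_trans (h0 (Ordinal hM0)) _; exact: (le_bigmax _ h).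
have H1f : H1 \is a fin_num.
  rewrite ge0_fin_numE//; apply: bigmax_lt => // m _.
  by have := hfin m; rewrite ge0_fin_numE.
have q0 m : (0 <= h m / mu (ccI (c m) (e m)))%E by rewrite mule_ge0// inve_ge0.
have q_le m : (h m / mu (ccI (c m) (e m)) <= H2)%E.
  exact: (le_bigmax _ (fun m => h m / mu (ccI (c m) (e m)))%E).
have H20 : (0 <= H2)%E by exact: le_trans (q0 (Ordinal hM0)) (q_le _).
have V0 := class_variation_ge0 mu f.
have N1E : ('N[mu]_1[EFin \o f] = \int[mu]_x `|f x|%:E)%E by rewrite Lnorm1.
have N10 : (0 <= 'N[mu]_1[EFin \o f])%E by exact: Lnorm_ge0.
have N1f : 'N[mu]_1[EFin \o f]%E \is a fin_num.
  by rewrite ge0_fin_numE// N1E; case/integrableP: intf.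
(* [H2] may be [+oo], and [+oo * 0 = 0], so a null [f] is treated apart: its transfer vanishes
   almost everywhere. *)
have [f0|fN0] := eqVneq ('N[mu]_1[EFin \o f])%E 0%E.
  apply: (@le_trans _ _ 0%E); last by rewrite adde_ge0// mule_ge0// adde_ge0.
  have nz : mu.-negligible [set x | f x <> 0].
    have := f0; rewrite Lnorm1 => /ae_eq_integral_abs.
    have mf' : measurable_fun setT (EFin \o f) by exact/measurable_EFinP.
    move=> /(_ measurableT mf'); apply: negligibleS => x /= fx /(_ Logic.I) [].
    exact: fx.
  have [_ cm _ _] := sa_measure hM.
  have tn := transfer_null (sa_preserves hM) (sa_g_ge0 hM) (cm _ nz)
    (measure_negligible (cm _ nz) nz).
  apply: (@le_trans _ _ (pointwise_variation setT (cst 0 : X -> R))); last first.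
    apply: (@dominated_variation _ _ _ _ (cst 0)) => [x y _ _ _|x] /=.
      by rewrite subrr normr0.
    by rewrite lexx.
  apply: ereal_inf_lbound; exists (cst 0) => //=.
  apply: filterS tn => x hx; rewrite /transfer.
  have z y : T y = x -> g y * f y = 0.
    move=> Ty; have [->|/eqP fy] := eqVneq (f y) 0; first by rewrite mulr0.
    by rewrite (hx y) ?mul0r.
  rewrite !esum1 ?sube0//.
    by move=> y Ty; rewrite funenegE/= z// oppr0 maxxx.
  by move=> y Ty; rewrite funeposE/= z// maxxx.
(* The norm being positive, an infinite [H2] makes the right-hand side infinite. *)
have [H2oo|H2N] := eqVneq H2 +oo%E.
  have -> : (S2 + H2 = +oo)%E by rewrite H2oo addey// -ltNye (lt_le_trans _ S20).
  rewrite gt0_mulye ?lt0e ?fN0// addey ?leey// -ltNye (@lt_le_trans _ _ 0%E)//.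
  by rewrite mule_ge0// adde_ge0.
have H2f : H2 \is a fin_num by rewrite ge0_fin_numE// ltey.
have vff : class_variation mu setT f \is a fin_num by rewrite ge0_fin_numE.
rewrite -(fineK S1f) -(fineK H1f) -(fineK S2f) -(fineK H2f) -(fineK vff) -(fineK N1f).
rewrite -!EFinD; set A := fine S1 + fine H1.
have A0 : 0 <= A by rewrite addr_ge0// fine_ge0.
apply/lee_addgt0Pr => eps eps0.
have A1 : 0 < A + 1 by rewrite ltr_wpDl.
(* The infimum defining the variation of the class need not be attained. A representative within
   [eps / (A + 1)] costs at most [eps] after multiplication by [A], even when [A = 0]. *)
have d0 : 0 < eps / (A + 1) by rewrite divr_gt0.
have [_ [f' ff' <-] lt] := lb_ereal_inf_adherent d0 vff.
set V := fine (class_variation mu setT f) + eps / (A + 1).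
have V0' : 0 <= V by rewrite addr_ge0 ?fine_ge0// ltW.
have vle : (pointwise_variation setT f' <= V%:E)%E.
  by rewrite /V EFinD fineK// ltW.
have [W [WV Wm dW]] := variation_function V0' vle.
have main := transfer_variation hM intf ff' hM0 hJdisj hJnull hJH WV Wm dW
  (G := fine \o G) (Vg := fine \o Vg) (h := fine \o h)
  (A1 := fine S1) (A2 := fine H1) (B1 := fine S2) (B2 := fine H2).
apply: le_trans (main _ _ _ _ _ _ _ _ _ _ _ _ _) _.
- exact: fine_ge0.
- exact: fine_ge0.
- by move=> n; exact: fine_ge0.
- by move=> n; exact: fine_ge0.
- by move=> m; exact: fine_ge0.
- by move=> n; exact: (essential_boundP _ _ (sa_g_ge0 hM) gB).
- move=> n In0; rewrite /= /G essential_bound_null//; first exact: measurable_ooI.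
  apply/eqP; rewrite eq_le measure_ge0 andbT -In0; apply: le_measure; rewrite ?inE//.
    exact: measurable_ooI.
  exact: ooI_ccI.
- by move=> n; rewrite /= fineK.
- by move=> n; rewrite -lee_fin EFinD !fineK.
- by move=> n; rewrite -lee_fin fineK.
- move=> m s us hs; rewrite -lee_fin fineK// -sumEFin (fsbig_seq _ _ us).
  apply: ereal_sup_ubound; exists [set` s] => //; split; first exact: finite_seq.
  by move=> p /= ps; have [] := hs p ps.
- by move=> m; rewrite /= fine_le//; exact: (le_bigmax _ h).
- move=> m; rewrite -lee_fin fineK//; apply: le_of_dive_le => //.
    exact: probability_le1.
  by rewrite fineK.
rewrite -N1E lee_fin /V mulrDr -addrA [X in _ + X]addrC addrA lerD2l.
rewrite mulrCA; apply: ler_piMr; first exact: ltW.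
by rewrite ler_pdivrMr// mul1r lerDl.
Qed.
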